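(* Let $r\geq1$ and $e\geq2$ be integers ($e<\infty$), let $\mathbf{a}=(a_1,\dots,a_r)\in(\mathbb{Z}/e\mathbb{Z})^r$, and let $\Theta=\Theta(e;\mathbf{a})$ be the $(e;\mathbf{a})$-hub of the empty multipartition. Let $\theta$ be an $e$-hub satisfying the following equivalent conditions: there exists an $(e;\mathbf{a})$-block with hub $\theta$; $\Theta\stackrel{e}{\mapsto}\theta$; $\sum_{x=0}^{e-1}x\,\theta_{x+e\mathbb{Z}}\equiv\sum_{x=0}^{e-1}x\,\Theta_{x+e\mathbb{Z}}\pmod e$. Then $v(\Theta)\stackrel{r}{\mapsto}v(\theta)$, and the weight of the core block with hub $\theta$ is $\operatorname{ht}(v(\theta)-v(\Theta))$.
   Context: Multipartitions. A multipartition is an $r$-tuple $\boldsymbol{\lambda}=(\lambda^{(1)},\dots,\lambda^{(r)})$ of partitions, identified with its Young diagram $\{(i,j)_k : i,j\geq 1,\ 1\leq k\leq r,\ j\leq\lambda^{(k)}_i\}$, whose elements are called nodes. A node of $\boldsymbol{\lambda}$ is removable if deleting it leaves the Young diagram of a multipartition; a node not in $\boldsymbol{\lambda}$ is addable if adding it gives the Young diagram of a multipartition. Residues and blocks. The residue of $(i,j)_k$ is $j-i+a_k\in\mathbb{Z}/e\mathbb{Z}$; a node of residue $l$ is an $l$-node. For $l\in\mathbb{Z}/e\mathbb{Z}$, $c_l(\boldsymbol{\lambda})$ is the number of $l$-nodes of $\boldsymbol{\lambda}$; the content of $\boldsymbol\lambda$ is $(c_l(\boldsymbol\lambda))_{l}$.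 An $(e;\mathbf{a})$-block is an equivalence class of multipartitions under the relation of having the same content. Hub and weight. An $e$-hub is a tuple $\theta=(\theta_i)_{i\in\mathbb{Z}/e\mathbb{Z}}$ of integers with $\sum_i\theta_i=-r$. The hub of $\boldsymbol\lambda$ is $(\theta_i(\boldsymbol\lambda))_{i}$, where $\theta_i(\boldsymbol\lambda)$ is the number of removable $i$-nodes minus the number of addable $i$-nodes of $\boldsymbol\lambda$. The weight of $\boldsymbol\lambda$ is $$w(\boldsymbol\lambda)=\sum_{j=1}^r c_{a_j}(\boldsymbol\lambda)-\tfrac12\sum_{i\in\mathbb{Z}/e\mathbb{Z}}(c_i(\boldsymbol\lambda)-c_{i-1}(\boldsymbol\lambda))^2,$$ which is known to be a non-negative integer. Two multipartitions are in the same block if and only if they have the same hub and the same weight (known); these are called the hub and weight of the block. $\Theta$ is given by $\Theta_i=-|\{j\in\{1,\dots,r\}: a_j=i\}|$. Core blocks. A multi-charge is $\hat{\mathbf a}=(\hat a_1,\dots,\hat a_r)\in\mathbb{Z}^r$ with $\hat a_j+e\mathbb{Z}=a_j$ for all $j$. The corresponding beta-sets of $\boldsymbol\lambda$ are $B^j=\{\lambda^{(j)}_i+\hat a_j-i: i\geq1\}$. $\boldsymbol\lambda$ is a multicore if there are no $i\in\mathbb{Z}$ and $j$ with $i\in B^j$ and $i-e\notin B^j$ (independent of the multi-charge). Put $\mathfrak{b}^{\hat{\mathbf a}}_{ij}(\boldsymbol\lambda)=\max\{\beta\in B^j:\beta+e\mathbb{Z}=i\}$ for $i\in\mathbb{Z}/e\mathbb{Z}$.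 A block $B$ is a core block if some (equivalently, every) $\boldsymbol\lambda\in B$ is a multicore for which there exist a multi-charge $\hat{\mathbf a}$ and integers $(b_i)_{i\in\mathbb{Z}/e\mathbb{Z}}$ with $\mathfrak{b}^{\hat{\mathbf a}}_{ij}(\boldsymbol\lambda)\in\{b_i,b_i+e\}$ for all $i,j$. It is known that this is equivalent to each of: there is no block with the same hub as $B$ and smaller weight; every multipartition in $B$ is a multicore. Hence if there is a block with hub $\theta$, there is a unique core block with hub $\theta$. The vectors $v(\theta)$, $v(\Theta)$. Elements of $\mathbb{Z}/n\mathbb{Z}$ are regarded as cosets; for $i\in\mathbb{Z}/n\mathbb{Z}$ and $z\in\mathbb{Z}$, the product $zi$ is regarded as an element of $\mathbb{Z}/zn\mathbb{Z}$. For an $e$-hub $\theta$ and $i\in\mathbb{Z}/e\mathbb{Z}$ define $t_i(\theta)\in\mathbb{Z}/er\mathbb{Z}$ by $$t_i(\theta)=ri+\theta_{i-1}+2\theta_{i-2}+\dots+(e-1)\theta_{i+1}=ri+\sum_{x=1}^{e-1}x\,\theta_{i-x}.$$ When $\Theta\stackrel{e}{\mapsto}\theta$, all the $t_i(\theta)$ and all the $t_i(\Theta)$ have the same reduction modulo $e$; let $h\in\{0,\dots,e-1\}$ be the integer representing this common reduction. For $j\in\mathbb{Z}/r\mathbb{Z}$ put $v_j(\theta)=|\{i\in\mathbb{Z}/e\mathbb{Z}: h-t_i(\theta)=ej\}|$ and $v_j(\Theta)=|\{i\in\mathbb{Z}/e\mathbb{Z}: h-t_i(\Theta)=ej\}|$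 (with $ej\in\mathbb{Z}/er\mathbb{Z}$), and $v(\theta)=(v_j(\theta))_{j}$, $v(\Theta)=(v_j(\Theta))_j$ in $\mathbb{Z}^{\mathbb{Z}/r\mathbb{Z}}$. The relations $\stackrel{n}{\mapsto}$ (for $n=e$ or $n=r$). For $i\in\mathbb{Z}/n\mathbb{Z}$ let $\alpha_i\in\mathbb{Z}^{\mathbb{Z}/n\mathbb{Z}}$ be given by $(\alpha_i)_j=-\delta_{(i-1)j}+2\delta_{ij}-\delta_{(i+1)j}$. For $x,y\in\mathbb{Z}^{\mathbb{Z}/n\mathbb{Z}}$, $x\stackrel{n}{\mapsto}y$ means $y-x=\sum_{i\in\mathbb{Z}/n\mathbb{Z}}m_i\alpha_i$ for some non-negative integers $m_i$. In that case there is a unique such choice of the $m_i$ with all $m_i\geq0$ and at least one $m_i$ equal to $0$, and $\operatorname{ht}(y-x)=\sum_i m_i$ for this choice. *)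

(* Defs.v *)
From HB Require Import structures.
From mathcomp Require Import all_boot all_order all_algebra.
From mathcomp Require Import finmap.
From mathcomp Require Import boolp classical_sets functions cardinality.

Set Implicit Arguments.
Unset Strict Implicit.
Unset Printing Implicit Defensive.

Import Order.TTheory GRing.Theory Num.Theory.
Local Open Scope classical_set_scope.
Local Open Scope ring_scope.

(* The additive group Z/nZ for n >= 1. The library's 'Z_n is Z/2Z when n = 1,
   and n = r = 1 must be allowed here. *)
Notation Zmod n := 'I_n.-1.+1.

(* The coset z + nZ. *)
Definition cl (n : nat) (z : int) : Zmod n := Zp1 *~ z.

Record partition := Partition {
  parts :> seq nat;
  partsP : sorted geq parts && (0%N \notin parts) }.

(* 1-based, with infinitely many trailing zeros. *)
Definition part (p : partition) (i : nat) : nat := nth 0%N p i.-1.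

Definition empty_partition : partition := @Partition [::] isT.

Definition multipartition (r : nat) := 'I_r -> partition.

Definition empty_mp (r : nat) : multipartition r := fun=> empty_partition.
Arguments empty_mp : clear implicits.

(* (i, j, k) stands for (i,j)_k; i and j start from 1, while the component
   index k ranges over 0, ..., r-1. *)
Definition node (r : nat) : Type := (nat * nat * 'I_r)%type.

Definition young r (lam : multipartition r) : set (node r) :=
  [set x : node r | let: (i, j, k) := x in
     [/\ (1 <= i)%N, (1 <= j)%N & (j <= part (lam k) i)%N]].

Definition removable r (lam : multipartition r) : set (node r) :=
  [set x | young lam x /\
     exists mu : multipartition r, young mu = young lam `\ x].

Definition addable r (lam : multipartition r) : set (node r) :=
  [set x | ~ young lam x /\
     exists mu : multipartition r, young mu = young lam `|` [set x]].

Definition residue e r (a : 'I_r -> Zmod e) (x : node r) : Zmod e :=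
  let: (i, j, k) := x in cl e (j%:Z - i%:Z) + a k.

(* The number of nodes of residue l in A; only used on finite sets A. *)
Definition count_res e r (a : 'I_r -> Zmod e) (l : Zmod e)
    (A : set (node r)) : nat :=
  #|` fset_set (A `&` [set x | residue a x = l])|.

Definition content e r (a : 'I_r -> Zmod e) (lam : multipartition r) :
    {ffun Zmod e -> nat} :=
  [ffun l => count_res a l (young lam)].

Definition hub e r (a : 'I_r -> Zmod e) (lam : multipartition r) :
    {ffun Zmod e -> int} :=
  [ffun i => (count_res a i (removable lam))%:Z
             - (count_res a i (addable lam))%:Z].

Definition is_hub e (r : nat) (theta : {ffun Zmod e -> int}) : Prop :=
  \sum_i theta i = - r%:Z.

Definition weight e r (a : 'I_r -> Zmod e) (lam : multipartition r) : rat :=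
  let c l : rat := (content a lam l)%:R in
  \sum_(j < r) c (a j) - 2^-1 * \sum_(i : Zmod e) (c i - c (i - cl e 1)) ^+ 2.

Definition is_block e r (a : 'I_r -> Zmod e) (B : set (multipartition r)) :
    Prop :=
  exists lam : multipartition r,
    B = [set mu | content a mu = content a lam].

Definition block_hub e r (a : 'I_r -> Zmod e) (B : set (multipartition r))
    (theta : {ffun Zmod e -> int}) : Prop :=
  forall lam, B lam -> hub a lam = theta.

Definition block_weight e r (a : 'I_r -> Zmod e) (B : set (multipartition r))
    (w : rat) : Prop :=
  forall lam, B lam -> weight a lam = w.

Definition multicharge e r (a : 'I_r -> Zmod e) (ahat : 'I_r -> int) : Prop :=
  forall j, cl e (ahat j) = a j.

Definition beta_set r (ahat : 'I_r -> int) (lam : multipartition r)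
    (j : 'I_r) : set int :=
  [set b | exists2 i : nat, (1 <= i)%N &
     b = (part (lam j) i)%:Z + ahat j - i%:Z].

Definition multicore e r (a : 'I_r -> Zmod e) (lam : multipartition r) :
    Prop :=
  forall ahat, multicharge a ahat ->
  ~ exists (i : int) (j : 'I_r),
      beta_set ahat lam j i /\ ~ beta_set ahat lam j (i - e%:Z).

(* The largest element of a set of integers that has one (0 otherwise). *)
Definition max_int (A : set int) : int :=
  xget 0 [set b | A b /\ forall b', A b' -> b' <= b].

Definition top_beta e r (ahat : 'I_r -> int) (lam : multipartition r)
    (i : Zmod e) (j : 'I_r) : int :=
  max_int (beta_set ahat lam j `&` [set b | cl e b = i]).

Definition core_block e r (a : 'I_r -> Zmod e) (B : set (multipartition r)) :
    Prop :=
  is_block a B /\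
  exists lam : multipartition r, [/\ B lam, multicore a lam &
    exists (ahat : 'I_r -> int) (b : Zmod e -> int), multicharge a ahat /\
      forall (i : Zmod e) (j : 'I_r),
        top_beta ahat lam i j = b i \/ top_beta ahat lam i j = b i + e%:Z].

Definition alpha (n : nat) (i : Zmod n) : {ffun Zmod n -> int} :=
  [ffun j => - (j == i - cl n 1)%:R + 2 * (j == i)%:R - (j == i + cl n 1)%:R].

Definition mapsto (n : nat) (x y : {ffun Zmod n -> int}) : Prop :=
  exists m : {ffun Zmod n -> nat}, y - x = \sum_i alpha i *+ m i.

(* The value \sum_i m_i for the unique family m of natural numbers, at least
   one of them 0, with z = \sum_i m_i alpha_i (0 if there is none). *)
Definition ht (n : nat) (z : {ffun Zmod n -> int}) : nat :=
  xget 0%N [set N | exists m : {ffun Zmod n -> nat},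
    [/\ z = \sum_i alpha i *+ m i, (exists i, m i = 0%N) & N = (\sum_i m i)%N]].

(* r * i is the product of the coset i by r, an element of Z/(er)Z. *)
Definition tvec e (r : nat) (theta : {ffun Zmod e -> int}) (i : Zmod e) :
    Zmod (e * r) :=
  cl (e * r) (r%:Z * (i : nat)%:Z
              + \sum_(1 <= x < e) x%:Z * theta (i - cl e x%:Z)).

(* h reduces modulo e every t_i(theta); the reduction of an element of
   Z/(er)Z is read off its representative. *)
Definition common_reduction e (r : nat) (theta : {ffun Zmod e -> int})
    (h : nat) : Prop :=
  (h < e)%N /\ forall i : Zmod e, (tvec r theta i : nat) = h %[mod e].

Definition vvec e (r h : nat) (theta : {ffun Zmod e -> int}) :
    {ffun Zmod r -> int} :=
  [ffun j : Zmod r => #|[pred i : Zmod e |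
     cl (e * r) h%:Z - tvec r theta i == cl (e * r) (e * j)%N%:Z]|%:Z].

(* Main.v *)
Require Import Defs.
From mathcomp Require Import all_boot all_order all_algebra.
From mathcomp Require Import boolp classical_sets functions cardinality.
From mathcomp Require Import finmap perm zify ring.

(** Both sides of the theorem are read off one table of numbers, the abacus.
Choose natural charges c_k, congruent to a_k modulo e and exceeding the number
of parts of lambda^(k). Only c_k beta-numbers of lambda^(k) are then natural
numbers (the beads), and all negative integers are beta-numbers. Let p_lk be
the number of beads of component k in the residue class l (the runner l), and
P_l = sum_k p_lk; write p0_lk and P0_l for the empty multipartition with the
same charges.

Hub and v. Counting row by row gives
theta_l = P_l - P_(l-1) - r [l = 0] ([hub_runners]) and
c_l - c_(l+1) = P_l - P0_l ([content_step]). So a hub amounts to an integer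
vector P up to a constant, called a potential below. An Abel summation turns
t_i into S - e P_i with S = sum_l P_l ([tvec_potential]), hence v_j counts the
i for which P_i lies in a certain residue class modulo r, shifting with j
([potential_vvec]). The hypothesis on theta, in each of its three forms, says
that theta has a potential whose sum is the sum of the charges
([potential_exists]).

Weight of a core block. For a core block the charges can be chosen so that
each row (p_l1, ..., p_lr) is balanced: its entries differ by at most 1
([core_charge]). Then the charges differ by at most e, so the rows of p0 are
balanced too. In a balanced row with sum P the s smallest entries add up to
L_s(P) = sum_(t < s) floor((P + t) / r). Let
gap(s) = sum_l (L_s(P0_l) - L_s(P_l)). In p0 the s components of smallest
charge are the smallest in all rows at once, so over them p0 adds up to
sum_l L_s(P0_l); p has the same column sums, so gap(s) >= 0 for s < r
([core_gap_ge0]). Moreover gap(0) = 0, gap is periodic modulo r, and its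
second differences count the P_l and P0_l in a residue class. Thus the values
of gap are the coefficients m_i expressing v(theta) - v(Theta)
([vvec_gap]), and the height is sum_(s < r) gap(s). On the other hand the weight
is a quadratic expression in p ([weight_runners]), and for balanced rows the
sum of all L_s is quadratic as well ([row_energy]); comparing them, the weight
is sum_(s < r) gap(s) ([core_weight]).

Existence. Start from a potential P of theta and charges that have the right
sum and lie within e of each other. Adding e to the s0 smallest charges and s0 to each P_l replaces gap(s) by
gap(s0 + s) - gap(s0), which is nonnegative when s0 minimises gap. This
inequality is exactly what is needed, in the manner of the Gale-Ryser theorem,
for a matrix p with balanced rows, row sums P_l and column sums c_k to exist
([balanced_matrix]); p is the abacus of the required core
([core_block_with_hub]).

Uniqueness. Contents with the same hub differ by a constant d, because
harmonic functions on a cycle are constant, and then the weights differ by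
r d ([content_hub_weight]). The weight of a core block being determined by its
hub, so is its content. *)

Import Order.TTheory GRing.Theory Num.Theory.
Local Open Scope classical_set_scope.
Local Open Scope ring_scope.
Set Implicit Arguments.
Unset Strict Implicit.
Unset Printing Implicit Defensive.

Arguments cl : simpl never.

(** * Residue classes, the vectors alpha and the height *)

Lemma clD n x y : cl n (x + y) = cl n x + cl n y.
Proof. exact: mulrzDr. Qed.

Lemma clB n x y : cl n (x - y) = cl n x - cl n y.
Proof. exact: mulrzBr. Qed.

Lemma cl0 n : cl n 0 = 0.
Proof. exact: mulr0z. Qed.

Lemma clS n (k : nat) : cl n k.+1 = cl n k + cl n 1.
Proof. by rewrite -clD -PoszD addn1. Qed.

Lemma val_cl_nat n (k : nat) : (0 < n)%N -> cl n k = (k %% n)%N :> nat.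
Proof.
case: n => // n _; rewrite /cl -pmulrn Zp_mulrn /=.
by rewrite modnMml mul1n.
Qed.

Lemma cl_val n (i : Zmod n) : (0 < n)%N -> cl n (i : nat) = i.
Proof.
move=> n0; apply/val_inj; rewrite /= val_cl_nat // modn_small //.
by case: n n0 i => // n _ i; exact: ltn_ord.
Qed.

Lemma cl_eq0 n (z : int) : (0 < n)%N -> (cl n z == 0) = (n%:Z %| z)%Z.
Proof.
move=> n0; case: (intP z) => [|k|k].
- by rewrite cl0 eqxx dvdz0.
- by rewrite -val_eqE /= val_cl_nat.
- rewrite /cl mulrNz oppr_eq0 -/(cl n k.+1) -val_eqE /= val_cl_nat //.
Qed.

Lemma cl_eq n (x y : int) : (0 < n)%N -> (cl n x == cl n y) = (n%:Z %| x - y)%Z.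
Proof. by move=> n0; rewrite -subr_eq0 -clB cl_eq0. Qed.

Lemma cl_addM n (x k : nat) : (0 < n)%N -> cl n (x + n * k)%N%:Z = cl n x%:Z.
Proof.
move=> n0; rewrite PoszD clD -[RHS]addr0; congr (_ + _).
by apply/eqP; rewrite cl_eq0 // dvdzE /= dvdn_mulr.
Qed.

Lemma sum_delta (I : finType) (k : I) (f : I -> int) :
  \sum_i (k == i)%:R * f i = f k.
Proof.
rewrite (bigD1 k) //= eqxx mul1r big1 ?addr0 // => i ik.
by rewrite eq_sym (negbTE ik) mul0r.
Qed.

Lemma sum_alphaE n (m : {ffun Zmod n -> nat}) j :
  (\sum_i alpha i *+ m i) j =
    2 * (m j)%:Z - (m (j + cl n 1))%:Z - (m (j - cl n 1))%:Z.
Proof.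
rewrite sum_ffunE.
transitivity (\sum_i (2 * ((j == i)%:R * (m i)%:Z)
   - (j + cl n 1 == i)%:R * (m i)%:Z - (j - cl n 1 == i)%:R * (m i)%:Z)).
  apply: eq_bigr => i _; rewrite ffunMnE ffunE -mulr_natr.
  rewrite -!(subr_eq j) opprK natz; ring.
by rewrite !sumrB -mulr_sumr !sum_delta.
Qed.

(** The increments of a harmonic function on a cycle are all equal, and they add
up to 0 around the cycle. Hence the relation between a vector and its
coefficients in the alpha_i is one-to-one up to constants. *)
Lemma harmonic_const n (d : Zmod n -> int) : (0 < n)%N ->
  (forall j, 2 * d j = d (j + cl n 1) + d (j - cl n 1)) ->
  forall j, d j = d 0.
Proof.
move=> n0 harm.
pose D j := d (j + cl n 1) - d j.
(* D is the increment; harmonicity says that it is constant. *)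
have Dk (k : nat) : D (cl n k) = D 0.
  elim: k => [|k IHk]; [by rewrite cl0|rewrite -IHk].
  have := harm (cl n k.+1); rewrite clS addrK /D; lia.
have D0 : D 0 = 0.
  have : \sum_j D j = 0.
    by rewrite sumrB [X in _ - X](reindex_inj (addIr (cl n 1))) subrr.
  rewrite (eq_bigr (fun=> D 0)) => [|j _]; last by rewrite -(cl_val j n0) Dk.
  by rewrite sumr_const card_ord => /eqP; rewrite mulrn_eq0 => /orP[|/eqP].
move=> j; rewrite -(cl_val j n0); elim: (nat_of_ord j) => [|k <-].
  by rewrite cl0.
by move: (Dk k); rewrite D0 clS /D => /eqP; rewrite subr_eq0 => /eqP.
Qed.

(** Two families of coefficients differ by a constant; a zero in each and the
signs force this constant to be 0. *)
Lemma ht_eq n (z : {ffun Zmod n -> int}) (m : {ffun Zmod n -> nat}) i0 :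
  (0 < n)%N -> z = \sum_i alpha i *+ m i -> m i0 = 0%N ->
  ht z = (\sum_i m i)%N.
Proof.
move=> n0 zE mi0; rewrite /ht; apply: xget_unique.
  by exists m; split => //; exists i0.
move=> N [m' [zE' [i1 m'i1] ->]]; apply: eq_bigr => i _.
have dE : forall i, (m i)%:Z - (m' i)%:Z = (m 0)%:Z - (m' 0)%:Z.
  apply: (@harmonic_const n (fun i => (m i)%:Z - (m' i)%:Z)) => // j.
  have := sum_alphaE m j; rewrite -zE zE' sum_alphaE; lia.
have := dE i; have := dE i0; have := dE i1; lia.
Qed.

(** * Balanced rows *)

(** This is the condition on the numbers b_i in the definition of a core block,
for one row of the abacus. *)
Definition balanced r (p : 'I_r -> nat) : Prop := forall j k, (p j <= (p k).+1)%N.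

(** The entries of a balanced row of length r and sum P, in increasing order, are
the quotients of P, P + 1, ..., P + r - 1 by r; hence this is the sum of the s
smallest ones. The formula makes sense for all s, which is what makes it
periodic up to a linear term. *)
Definition low_sum (r s P : nat) : nat := (\sum_(t < s) (P + t) %/ r)%N.

Lemma low_sumS r s P : low_sum r s.+1 P = (low_sum r s P + (P + s) %/ r)%N.
Proof. by rewrite /low_sum big_ord_recr. Qed.

Lemma low_sum0 r P : low_sum r 0 P = 0%N.
Proof. exact: big_ord0. Qed.

Lemma low_sumE r s P : (s <= r)%N ->
  (0 < r)%N -> low_sum r s P = (s * (P %/ r) + (s + P %% r - r))%N.
Proof.
move=> + r0; elim: s => [|s IHs] sr.
  by rewrite low_sum0; have := ltn_pmod P r0; lia.
rewrite low_sumS IHs ?(ltnW sr) //.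
have Pr := ltn_pmod P r0.
have -> : ((P + s) %/ r = P %/ r + (P %% r + s) %/ r)%N.
  by rewrite {1}(divn_eq P r) -addnA divnMDl.
move: (P %/ r)%N (P %% r)%N Pr {IHs} => q m mr.
have [lt|le] := ltnP (m + s) r; first by rewrite divn_small // mulSn; lia.
rewrite -[X in (X %/ r)%N](subnK le) divnDr ?dvdnn // divnn r0 divn_small; last by lia.
by rewrite mulSn; lia.
Qed.

Lemma low_sum_period r s P : (0 < r)%N ->
  low_sum r (s + r) P = (P + s + low_sum r s P)%N.
Proof.
move=> r0; elim: s => [|s IHs].
  rewrite low_sum0 low_sumE // addKn mulnC -divn_eq; lia.
rewrite addSn !low_sumS IHs addnA divnDr ?dvdnn // divnn r0; lia.
Qed.

(** The quotients of consecutive integers by r differ exactly at the multiples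
of r. This is how residue classes modulo r, and so the vectors v, enter. *)
Lemma low_sum_diff r s P : (0 < r)%N ->
  (low_sum r s.+2 P + low_sum r s P =
   2 * low_sum r s.+1 P + (r %| P + s.+1))%N.
Proof.
by move=> r0; rewrite !low_sumS addnS divnS //; lia.
Qed.

Section Balanced.
Variables (r : nat) (p : 'I_r -> nat).
Hypotheses (r0 : (0 < r)%N) (bal : balanced p).
Let P := (\sum_j p j)%N.

Lemma balanced_divn j : (P %/ r <= p j <= (P %/ r).+1)%N.
Proof.
have PE := divn_eq P r; have Pr := ltn_pmod P r0.
have sumc m : (\sum_(k < r) m = r * m)%N by rewrite sum_nat_const card_ord.
apply/andP; split; rewrite leqNgt; apply/negP => h.
  have : (\sum_k p k < r * (P %/ r))%N.
    rewrite -sumc (bigD1 j) //= [X in (_ < X)%N](bigD1 j) //=.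
    rewrite -addSn leq_add // leq_sum // => k _.
    by have := bal k j; lia.
  by rewrite -/P {1}PE mulnC; lia.
have : (r * (P %/ r).+1 < \sum_k p k)%N.
  rewrite -sumc (bigD1 j) //= [X in (_ < X)%N](bigD1 j) //=.
  rewrite -addSn leq_add // leq_sum // => k _.
  by have := bal j k; lia.
by rewrite -/P {2}PE; lia.
Qed.

Let high j : bool := (P %/ r < p j)%N.

Lemma balanced_highE j : p j = (P %/ r + high j)%N.
Proof. by have := balanced_divn j; rewrite /high; case: ltnP; lia. Qed.

Lemma balanced_sum_high : (\sum_j high j = P %% r)%N.
Proof.
have : P = (\sum_j (P %/ r + high j))%N.
  by apply: eq_bigr => j _; exact: balanced_highE.
rewrite big_split sum_nat_const card_ord {1}(divn_eq P r) mulnC => /eqP.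
by rewrite eqn_add2l => /eqP.
Qed.

Lemma balanced_sum_set (X : {set 'I_r}) :
  (\sum_(j in X) p j = #|X| * (P %/ r) + \sum_(j in X) high j)%N.
Proof.
rewrite (eq_bigr _ (fun j _ => balanced_highE j)) big_split.
by rewrite sum_nat_const.
Qed.

Lemma balanced_high_setC (X : {set 'I_r}) :
  (\sum_(j in X) high j + \sum_(j in ~: X) high j = P %% r)%N.
Proof.
rewrite -balanced_sum_high [RHS](bigID [in X]) /=; congr addn.
by apply: eq_bigl => j; rewrite inE.
Qed.

Lemma balanced_high_le (X : {set 'I_r}) : (\sum_(j in X) high j <= #|X|)%N.
Proof. by rewrite -sum1_card leq_sum // => j _; exact: leq_b1. Qed.

(** P mod r entries are equal to floor(P / r) + 1. X misses r - #|X| components, so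
all but at most that many of these larger entries lie in X. *)
Lemma low_sum_le (X : {set 'I_r}) : (low_sum r #|X| P <= \sum_(j in X) p j)%N.
Proof.
have Xr : (#|X| <= r)%N by rewrite -[r in (_ <= r)%N]card_ord max_card.
rewrite low_sumE // balanced_sum_set leq_add2l.
have := balanced_high_setC X; have := balanced_high_le (~: X); have := cardsC X; rewrite card_ord.
lia.
Qed.

(** If some entry in X is one of the larger ones, so are all entries outside X;
either way the number of larger entries in X is as small as possible. *)
Lemma low_sum_smallest (X : {set 'I_r}) :
  (forall j k, j \in X -> k \notin X -> (p j <= p k)%N) ->
  (\sum_(j in X) p j = low_sum r #|X| P)%N.
Proof.
move=> small; apply/eqP; rewrite eqn_leq low_sum_le andbT.
have Xr : (#|X| <= r)%N by rewrite -[r in (_ <= r)%N]card_ord max_card.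
rewrite low_sumE // balanced_sum_set leq_add2l.
have hC := balanced_high_setC X; have := cardsC X; rewrite card_ord => cC.
have [/existsP[j /andP[jX hj]]|] := boolP [exists j, (j \in X) && high j]; last first.
  rewrite negb_exists => /forallP no; rewrite big1 // => j jX.
  by move: (no j); rewrite jX /= => /negbTE ->.
suff : (\sum_(k in ~: X) high k = #|~: X|)%N by lia.
rewrite -sum1_card; apply: eq_bigr => k; rewrite inE => kX.
by have := small _ _ jX kX; move: hj; rewrite /high; case: ltnP; lia.
Qed.

(** With m = P mod r entries equal to floor(P / r) + 1, both terms on the left are
polynomials in r, P and m; m enters them through m (r - m), with opposite
signs. *)
Lemma row_energy :
  (r * (\sum_j p j * (p j).+1) + 2 * (\sum_(s < r) low_sum r s P) =
   P ^ 2 + (2 * r).-1 * P)%N.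
Proof.
have -> : (\sum_j p j * (p j).+1 =
    r * (P %/ r * (P %/ r).+1) + 2 * (P %/ r).+1 * (P %% r))%N.
  rewrite -balanced_sum_high big_distrr /=.
  have <- : (\sum_(j < r) P %/ r * (P %/ r).+1 = r * (P %/ r * (P %/ r).+1))%N.
    by rewrite sum_nat_const card_ord.
  rewrite -big_split /=; apply: eq_bigr => j _; rewrite (balanced_highE j).
  by move: (P %/ r)%N (high j) => q [] /=; nia.
have PE := divn_eq P r; have Pr := ltn_pmod P r0.
have -> : (2 * (\sum_(s < r) low_sum r s P) =
    r.-1 * r * (P %/ r) + P %% r * (P %% r).-1)%N.
  (* n + P mod r - r counts the larger entries among the n smallest ones, and the
     sum of the first such counts is triangular. *)
  suff H n : (n <= r)%N -> (2 * (\sum_(s < n) low_sum r s P) =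
    n.-1 * n * (P %/ r) + (n + P %% r - r) * (n + P %% r - r).-1)%N.
    by rewrite H // addKn.
  elim: n => [_|n IHn nr].
    by rewrite big_ord0 add0n (_ : P %% r - r = 0)%N //; lia.
  rewrite big_ord_recr /= mulnDr IHn ?(ltnW nr) // low_sumE ?(ltnW nr) //.
  move: (P %/ r)%N (P %% r)%N Pr {IHn PE} => q m mr.
  have [lt|le] := ltnP (n + m) r.
    have -> : (n + m - r = 0)%N by lia.
    have -> : (n.+1 + m - r = 0)%N by lia.
    by case: n {nr lt} => [|n] /=; nia.
  have -> : (n.+1 + m - r = (n + m - r).+1)%N by lia.
  by case: (n + m - r)%N => [|d]; case: n {nr le} => [|n] /=; nia.
move: (P %/ r)%N (P %% r)%N PE Pr => q m -> mr.
by case: (r) mr r0 => // n mr _; case: m mr => [|m] mr /=; nia.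
Qed.

End Balanced.

(** * Balanced matrices with prescribed margins *)

Lemma sum_ord_lt n m : (\sum_(i < n) (i < m) = minn m n)%N.
Proof.
elim: n => [|n IHn]; first by rewrite big_ord0 minn0.
by rewrite big_ord_recr /= IHn; case: ltnP; lia.
Qed.

Section BalancedMatrix.
Variables (I : finType) (r : nat).
Implicit Type p : I -> 'I_r -> nat.

Let col p j : nat := (\sum_i p i j)%N.

Let arc p (j k : 'I_r) : bool := [exists i, (p i k < p i j)%N].

(** Along an arc from j to k some row has entry q + 1 in column j and q in column
k. Swapping the two moves a unit from column j to column k and keeps the row
sum and the multiset of entries of the row. On a simple path the remaining arcs
survive the swap. *)
Lemma push_path s p j : (forall i, balanced (p i)) ->
  path (arc p) j s -> uniq (j :: s) ->
  exists p', [/\ forall i, balanced (p' i),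
    forall i, (\sum_k p' i k = \sum_k p i k)%N &
    forall x, (col p' x + (x == j) = col p x + (x == last j s))%N].
Proof.
elim: s p j => [|k s IHs] p j bal; first by move=> _ _; exists p.
rewrite /= inE negb_or => /andP[/existsP[i lti] ps] /and3P[/andP[jk js] ks us].
pose p1 i' x := if i' == i then p i (tperm j k x) else p i' x.
have bal1 i' : balanced (p1 i') by move=> x y; rewrite /p1; case: ifP => _; exact: bal.
have row1 i' : (\sum_x p1 i' x = \sum_x p i' x)%N.
  by rewrite /p1; case: eqP => [->|//]; rewrite [RHS](reindex_inj (@perm_inj _ (tperm j k))).
have col1 x : (col p1 x + (x == j) = col p x + (x == k))%N.
  rewrite /col (bigD1 i) //= [in RHS](bigD1 i) //= /p1 eqxx.
  rewrite (eq_bigr (fun i' => p i' x)); last by move=> i' /negbTE ->.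
  rewrite addnAC [RHS]addnAC; congr (_ + _)%N.
  have := bal i j k; case: tpermP => [->|->|/eqP/negbTE -> /eqP/negbTE ->].
  - by rewrite eqxx (negbTE jk); lia.
  - by rewrite eqxx eq_sym (negbTE jk); lia.
  - by [].
(* Arcs whose target is neither j nor k persist: entries outside the columns j
   and k are unchanged, and the entry in column k has only grown. *)
have keep t x : x != j -> path (arc p) x t -> j \notin t -> k \notin t ->
    path (arc p1) x t.
  elim: t x => //= y t IHt x xj /andP[/existsP[i' lti'] pt].
  rewrite !inE !negb_or => /andP[jy jt] /andP[ky kt].
  rewrite IHt 1?eq_sym // andbT; apply/existsP; exists i'; rewrite /p1.
  case: eqP lti' => [->|//]; rewrite (tpermD jy ky).
  by case: tpermP xj => [->|->|//]; rewrite ?eqxx //; lia.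
have ps1 : path (arc p1) k s by apply: keep; rewrite // eq_sym.
have [p' [bal' row' col']] := IHs p1 k bal1 ps1 (introT andP (conj ks us)).
exists p'; split=> // [i'|x]; first by rewrite row'.
by have := col' x; have := col1 x; lia.
Qed.

(** A Gale-Ryser theorem. Start from any matrix with balanced rows of the right
sums and push units from columns with a surplus to columns with a deficit. If
no column with a deficit can be reached from a surplus column j, then in each
row the columns reachable from j have the smallest entries. By
[low_sum_smallest] the total of these columns is then the left-hand side of the
inequality assumed for them, and the surplus makes it exceed the right-hand
side. *)
Lemma balanced_matrix (P : I -> nat) (A : 'I_r -> nat) : (0 < r)%N ->
  (\sum_i P i = \sum_j A j)%N ->
  (forall X : {set 'I_r}, (\sum_i low_sum r #|X| (P i) <= \sum_(j in X) A j)%N) ->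
  exists p, [/\ forall i, balanced (p i), forall i, (\sum_j p i j = P i)%N &
    forall j, (\sum_i p i j = A j)%N].
Proof.
move=> r0 PA dom.
pose dist p := (\sum_j (col p j - A j + (A j - col p j)))%N.
suff fit n p : (forall i, balanced (p i)) -> (forall i, (\sum_j p i j = P i)%N) ->
    (dist p <= n)%N -> exists p, [/\ forall i, balanced (p i),
    forall i, (\sum_j p i j = P i)%N & forall j, (\sum_i p i j = A j)%N].
  (* The initial matrix has the larger entries of each row in its first columns. *)
  apply: (fit _ (fun i j => P i %/ r + (j < P i %% r))%N _ _ (leqnn _)).
    by move=> i j k; case: (_ < _)%N; case: (_ < _)%N; lia.
  move=> i; rewrite big_split sum_nat_const card_ord [RHS](divn_eq _ r) mulnC.
  by rewrite sum_ord_lt; have /ltnW/minn_idPl -> := ltn_pmod (P i) r0.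
elim: n p => [|n IHn] p bal row.
  rewrite leqn0 sum_nat_eq0 => /forallP dp.
  by exists p; split=> // j; have := dp j; rewrite /col; lia.
move=> dn.
have colA : (\sum_j col p j = \sum_j A j)%N.
  by rewrite /col exchange_big -PA; apply: eq_bigr => i _; exact: row.
have [/forallP le|/forallPn[j]] := boolP [forall j, (col p j <= A j)%N].
  exists p; split=> // j; apply/eqP; rewrite eqn_leq le /=.
  rewrite leqNgt; apply/negP => lt; move: colA; apply/eqP; rewrite neq_ltn; apply/orP; left.
  rewrite (bigD1 j) //= [X in (_ < X)%N](bigD1 j) //= -addSn leq_add //.
  by apply: leq_sum => k _; exact: le.
rewrite -ltnNge => surplus.
pose X := finset (connect (arc p) j).
have [/existsP[k /andP[]]|] := boolP [exists k, (k \in X) && (col p k < A k)%N].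
  rewrite inE => /connectP[s ps kE] deficit.
  move: kE; case/shortenP: ps => s' ps' us' _ kE.
  have [p' [bal' row' col']] := push_path bal ps' us'.
  apply: (IHn p') => // [i|]; first by rewrite row'.
  rewrite -ltnS; apply: leq_trans dn; rewrite /dist.
  rewrite (bigD1 j) //= [X in (_ < X)%N](bigD1 j) //= -addSn leq_add //.
    have := col' j; rewrite -kE eqxx; case: (eqVneq j k) => [jk|_]; last by lia.
    by move: surplus deficit; rewrite jk; lia.
  apply: leq_sum => x /negbTE xj; have := col' x; rewrite -kE xj.
  by case: (eqVneq x k) => [->|_]; lia.
rewrite negb_exists => /forallP no_def.
have reach i' k l : k \in X -> l \notin X -> (p i' k <= p i' l)%N.
  rewrite !inE => jk; apply: contraR; rewrite -ltnNge => lt.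
  by apply: connect_trans jk (connect1 _); apply/existsP; exists i'.
have : (\sum_(k in X) col p k <= \sum_(k in X) A k)%N.
  apply: leq_trans (dom X); rewrite /col exchange_big /=; apply: leq_sum => i0 _.
  by rewrite -row (low_sum_smallest r0 (bal i0) (reach i0)).
have jX : j \in X by rewrite inE connect0.
rewrite (bigD1 j) //= [X in (_ <= X)%N](bigD1 j) //= leqNgt -addSn leq_add //.
apply: leq_sum => k /andP[kX _]; have := no_def k; rewrite kX /=; lia.
Qed.

End BalancedMatrix.

(** * Partitions from their rows, and counting nodes row by row *)

Lemma part_leS (p : Defs.partition) i : (part p i.+2 <= part p i.+1)%N.
Proof.
have [ps _] := andP (partsP p); rewrite /part; case: p ps => s _ /= ps.
have [lt_is|le_si] := ltnP i.+1 (size s); last by rewrite nth_default.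
by move/(sortedP 0%N): ps; apply.
Qed.

Lemma part_le (p : Defs.partition) i j :
  (1 <= i)%N -> (i <= j)%N -> (part p j <= part p i)%N.
Proof.
case: i => // i _; elim: j => // j IHj.
rewrite leq_eqVlt => /orP[/eqP <- //|]; rewrite ltnS => le_ij.
by apply: leq_trans (IHj le_ij); case: j le_ij {IHj} => // j _; exact: part_leS.
Qed.

Lemma part_big (p : Defs.partition) i : (size p < i)%N -> part p i = 0%N.
Proof. by case: i => // i; rewrite ltnS => le_i; rewrite /part nth_default. Qed.

Section MkPart.
Variables (f : nat -> nat) (M : nat).
Hypothesis f_dec : forall i, (f i.+1 <= f i)%N.
Hypothesis f0 : f M = 0%N.

Let s := [seq y <- [seq f i | i <- iota 0 M] | (0 < y)%N].

Fact mkpart_subproof : sorted geq s && (0%N \notin s).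
Proof.
rewrite mem_filter ltnn andbT sorted_filter //.
  by move=> x y z /= xy zx; exact: leq_trans zx xy.
apply/(sortedP 0%N) => i; rewrite size_map size_iota => ltiM.
have ltiM' := ltnW ltiM.
by rewrite !(nth_map 0%N) ?size_iota // !nth_iota //= f_dec.
Qed.

Definition mkpart := Partition mkpart_subproof.

Lemma noninc_le i j : (i <= j)%N -> (f j <= f i)%N.
Proof. move/subnK <-; elim: (j - i)%N => // k; apply: leq_trans; exact: f_dec. Qed.

(** The list of nonzero values is an initial segment of the values of f, since f
is nonincreasing. *)
Lemma part_mkpart i : part mkpart i.+1 = f i.
Proof.
rewrite /part /= /s; have [le_iM|/ltnW le_Mi] := leqP i M; last first.
  rewrite nth_default ?size_filter.
    by have := noninc_le le_Mi; rewrite f0; lia.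
  by apply: leq_trans (count_size _ _) _; rewrite size_map size_iota.
(* k is the number of nonzero values of f. *)
pose k := find (fun i => f i == 0)%N (iota 0 M).
have kM : (k <= M)%N by rewrite -[M in (_ <= M)%N](size_iota 0) find_size.
have fk j : (j < k)%N -> (0 < f j)%N.
  move=> jk; have := before_find 0%N jk.
  by rewrite nth_iota ?add0n ?lt0n ?(leq_trans jk kM)// => ->.
have fk0 : f k = 0%N.
  have [kltM|] := ltnP k M; last by move=> Mk; rewrite (_ : k = M)//; lia.
  have : has (fun i => f i == 0)%N (iota 0 M) by rewrite has_find size_iota.
  by move/(nth_find 0%N)/eqP; rewrite nth_iota.
have -> : [seq y <- [seq f i | i <- iota 0 M] | (0 < y)%N] = [seq f i | i <- iota 0 k].
  rewrite -(subnKC kM) iotaD map_cat filter_cat add0n.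
  rewrite (_ : filter _ [seq f i | i <- iota k _] = [::]) ?cats0.
    apply/all_filterP/allP => y /mapP[j jk ->]; apply: fk.
    by move: jk; rewrite mem_iota.
  apply/eqP; rewrite -size_eq0 size_filter -leqn0 leqNgt -has_count.
  apply/hasPn => y /mapP[j + ->]; rewrite mem_iota => /andP[kj _].
  by have := noninc_le kj; rewrite fk0; lia.
have [ik|ki] := ltnP i k; first by rewrite (nth_map 0%N) ?size_iota ?nth_iota.
rewrite nth_default ?size_map ?size_iota //.
by have := noninc_le ki; rewrite fk0; lia.
Qed.

Lemma size_mkpart : (size mkpart <= M)%N.
Proof. by rewrite size_filter (leq_trans (count_size _ _)) // size_map size_iota. Qed.

End MkPart.

Lemma card_fset_set (T : choiceType) (A : set T) (s : seq T) :
  uniq s -> (forall x, A x <-> x \in s) -> #|` fset_set A| = size s.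
Proof.
move=> us As; have -> : A = [set` [fset x in s]%fset].
  by apply/seteqP; split => x /=; rewrite !inE => /As.
by rewrite set_fsetK card_fseq undup_id.
Qed.

(** Contents and hubs are computed as sums over rows: the columns occupied in each
row are listed, so that the cardinal becomes such a sum. *)
Lemma count_res_rows e r (a : 'I_r -> Zmod e) l (A : set (node r))
    (c : 'I_r -> nat) (cols : 'I_r -> nat -> seq nat) :
  (forall k i, uniq (cols k i)) ->
  (forall i j k, A (i, j, k) <->
     exists2 i', i = i'.+1 & (i' < c k)%N && (j \in cols k i')) ->
  count_res a l A = (\sum_k \sum_(i < c k) \sum_(y <- cols k i)
     (residue a (i.+1, y, k) == l))%N.
Proof.
move=> ucols AE.
pose cells k := [seq (i.+1, y) | i <- iota 0 (c k), y <- cols k i].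
pose s : seq (node r) := [seq (x, k) | k <- enum 'I_r, x <- cells k].
have us : uniq s.
  apply: allpairs_uniq_dep => [|k _|]; first exact: enum_uniq.
    apply: allpairs_uniq_dep => [|i _|]; [exact: iota_uniq|exact: ucols|].
    by move=> [i y] [i' y'] _ _ /= [-> ->].
  by move=> [k x] [k' x'] _ _ /= [-> ->].
have sA x : A x <-> x \in s.
  case: x => -[i j] k; rewrite AE; split.
    case=> i' -> /andP[i'c jc]; apply/allpairsPdep; exists k, (i'.+1, j).
    split; rewrite ?mem_enum //; apply/allpairsPdep; exists i', j.
    by rewrite mem_iota.
  case/allpairsPdep => k' [x [_ + [xE kE]]]; rewrite -xE -kE.
  case/allpairsPdep => i' [y []]; rewrite mem_iota => /= i'c yc [-> ->].
  by exists i' => //; rewrite i'c.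
rewrite /count_res (@card_fset_set _ _ [seq x <- s | residue a x == l]).
- rewrite size_filter -sum1_count big_mkcond big_allpairs_dep /= big_enum /=.
  apply: eq_bigr => k _; rewrite big_allpairs_dep /=.
  rewrite -(big_mkord xpredT
    (fun i => \sum_(y <- cols k i) (residue a (i.+1, y, k) == l))%N).
  rewrite /index_iota subn0; apply: eq_bigr => i _.
  by apply: eq_bigr => y _; case: eqP.
- exact: filter_uniq.
- move=> x; rewrite mem_filter /=; split.
    by case=> /sA -> ->; rewrite eqxx.
  by case/andP => /eqP xl /sA.
Qed.

(** * Beads, contents and hubs *)

(** The beta-number of row i + 1 for the charge c, which is a natural number as
long as i < c. *)
Definition bead (p : Defs.partition) (c i : nat) : nat :=
  (part p i.+1 + (c - i.+1))%N.

Definition bead_sum (F : nat -> nat) (p : Defs.partition) (c : nat) : nat :=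
  (\sum_(i < c) F (bead p c i))%N.

Definition runner e (p : Defs.partition) (c : nat) (l : Zmod e) : nat :=
  bead_sum (fun x => cl e x%:Z == l) p c.

Definition runners e r (lam : multipartition r) (c : 'I_r -> nat) (l : Zmod e)
    : nat :=
  (\sum_k runner (lam k) (c k) l)%N.

(** The number of l-nodes in a row is the difference of two values of this
function, at the bead of the row and at the bead of an empty row. *)
Definition res_upto e (l : Zmod e) (x : nat) : nat :=
  (\sum_(0 <= z < x.+1) (cl e z%:Z == l))%N.

(** The strict inequality leaves an empty last row, so that 0 is always a bead;
sums over the rows 1, ..., c_k then see all removable and addable nodes. *)
Definition charge_for e r (a : 'I_r -> Zmod e) (lam : multipartition r)
    (c : 'I_r -> nat) : Prop :=
  forall k, cl e (c k)%:Z = a k /\ (size (lam k) < c k)%N.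

Lemma part_empty i : part empty_partition i = 0%N.
Proof. by rewrite /part nth_nil. Qed.

Lemma residue_row e r (a : 'I_r -> Zmod e) (c : 'I_r -> nat) i y k :
  cl e (c k)%:Z = a k -> (i < c k)%N ->
  cl e (y%:Z - i.+1%:Z) + a k = cl e (y + (c k - i.+1))%N%:Z.
Proof.
by move=> ck ic; rewrite -ck -clD; congr cl; lia.
Qed.

(** The residues in row i of component k are those of the integers from
c_k - i + 1 up to the bead of this row. *)
Lemma content_beads e r (a : 'I_r -> Zmod e) lam c l : charge_for a lam c ->
  (content a lam l + \sum_k bead_sum (res_upto l) empty_partition (c k) =
   \sum_k bead_sum (res_upto l) (lam k) (c k))%N.
Proof.
move=> ca; rewrite ffunE.
rewrite (@count_res_rows _ _ _ _ _ c (fun k i => iota 1 (part (lam k) i.+1))).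
- rewrite -big_split; apply: eq_bigr => k _ /=.
  rewrite -big_split; apply: eq_bigr => i _ /=.
  have [ck _] := ca k.
  under eq_bigr do rewrite (residue_row _ ck (ltn_ord i)).
  rewrite /res_upto /bead part_empty add0n -addSn addnC.
  rewrite [RHS](@big_cat_nat _ _ _ (c k - i.+1).+1) //=; last by rewrite addSn ltnS leq_addl.
  congr addn.
  rewrite -[iota _ _](_ : index_iota 1 (part (lam k) i.+1).+1 = _).
    rewrite -[(_ - _).+1]add1n big_addn addnC.
    by rewrite (_ : (_ + _ - _)%N = (part (lam k) i.+1).+1) //; lia.
  by rewrite /index_iota subSS subn0.
- by move=> k i; exact: iota_uniq.
- move=> i j k; rewrite /young /=; split.
    case; case: i => // i _ j1 jp; exists i => //.
    rewrite mem_iota j1 add1n ltnS jp !andbT ltnNge; apply/negP => ci.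
    by have [_ sk] := ca k; rewrite part_big // in jp; lia.
  by case=> i' -> /andP[_]; rewrite mem_iota add1n ltnS => /andP[].
Qed.

(** If deleting the node leaves a diagram, then the nodes below it and to its
right were absent. *)
Lemma removableP r (lam : multipartition r) i j k :
  removable lam (i, j, k) <->
  exists i', [/\ i = i'.+1, j = part (lam k) i & (part (lam k) i.+1 < part (lam k) i)%N].
Proof.
split.
  case=> -[i1 j1 jp] [mu muE].
  have muP x : young mu x <-> young lam x /\ x <> (i, j, k).
    by have := congr1 (fun A => A x) muE; rewrite /= => ->.
  case: i i1 j1 jp muE muP => // i _ j1 jp _ muP; exists i.
  have nij : ~ young mu (i.+1, j, k) by move=> /muP[].
  have jS : ~ (j <= part (lam k) i.+2)%N.
    move=> jp'; apply: nij.
    have [_ _ h] : young mu (i.+2, j, k) by apply/muP; split=> // -[]; lia.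
    by split=> //; exact: leq_trans h (part_leS _ _).
  have Sj : ~ (j < part (lam k) i.+1)%N.
    move=> jp'; apply: nij.
    have [_ _ h] : young mu (i.+1, j.+1, k) by apply/muP; split=> // -[]; lia.
    by split=> //; exact: ltnW.
  by split=> //; lia.
case=> i' [-> -> lti]; split; first by split=> //; lia.
pose f n := (part (lam k) n.+1 - (n == i'))%N.
pose M := (size (lam k)).
have f_dec n : (f n.+1 <= f n)%N.
  have := part_leS (lam k) n; rewrite /f.
  by case: eqP => [->|_]; case: eqP => // [e1|_]; subst; lia.
have fM : f M = 0%N by rewrite /f part_big.
exists (fun k' => if k' == k then mkpart M f_dec else lam k').
have partE n k' : part (if k' == k then mkpart M f_dec else lam k') n.+1 =
    (part (lam k') n.+1 - ((k' == k) && (n == i')))%N.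
  by case: eqP => [->|_] /=; rewrite ?subn0 ?part_mkpart.
apply/seteqP; split => -[[n y] k'] /=; rewrite /young /=.
  case; case: n => // n _ y1; rewrite partE => yp; split; first by split=> //; lia.
  by case=> nE yE kE; move: yp; rewrite nE kE yE !eqxx /=; lia.
case=> -[]; case: n => // n _ y1 yp ne; split=> //; rewrite partE.
case: eqP => [kE|] /=; last by rewrite subn0.
case: eqP => [nE|] /=; last by rewrite subn0.
subst; suff : y <> part (lam k) i'.+1 by lia.
by move=> yE; apply: ne; rewrite yE.
Qed.

(** If adding the node gives a diagram, then the nodes above it and to its left
were present. *)
Lemma addableP r (lam : multipartition r) i j k :
  addable lam (i, j, k) <->
  exists i', [/\ i = i'.+1, j = (part (lam k) i).+1 &
    (i' == 0)%N || (part (lam k) i < part (lam k) i')%N].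
Proof.
split.
  case=> nij [mu muE].
  have muP x : young mu x <-> young lam x \/ x = (i, j, k).
    by have := congr1 (fun A => A x) muE; rewrite /= => ->.
  have [i1 j1 jp] : young mu (i, j, k) by apply/muP; right.
  case: i i1 jp nij muE muP => // i _ jp nij _ muP; exists i.
  have lj : (part (lam k) i.+1 < j)%N.
    by rewrite ltnNge; apply/negP => h; apply: nij.
  split=> //.
    case: j j1 jp nij muP lj => // -[|j] _ jp nij muP lj; first by lia.
    have /muP[[_ _]|] : young mu (i.+1, j.+1, k) by split=> //; exact: ltnW.
      by lia.
    by case; lia.
  case: i jp nij muP lj => // i jp nij muP lj; rewrite /=.
  have /muP[[_ _]|] : young mu (i.+1, j, k).
  - by split=> //; exact: leq_trans jp (part_leS _ _).
  - by move=> h; exact: leq_trans lj h.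
  - by case; lia.
case=> i' [-> -> lti]; split; first by case=> _ _; rewrite ltnn.
pose f n := (part (lam k) n.+1 + (n == i'))%N.
pose M := (size (lam k) + i').+1.
have f_dec n : (f n.+1 <= f n)%N.
  have := part_leS (lam k) n; rewrite /f.
  case: (eqVneq n.+1 i') => [e1|_]; case: (eqVneq n i') => [e2|_] //=; try lia.
  by move: lti; rewrite -e1 /=; lia.
have fM : f M = 0%N by rewrite /f part_big ?gtn_eqF; lia.
exists (fun k' => if k' == k then mkpart M f_dec else lam k').
have partE n k' : part (if k' == k then mkpart M f_dec else lam k') n.+1 =
    (part (lam k') n.+1 + ((k' == k) && (n == i')))%N.
  by case: eqP => [->|_] /=; rewrite ?addn0 ?part_mkpart.
apply/seteqP; split => -[[n y] k'] /=; rewrite /young /=.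
  case; case: n => // n _ y1; rewrite partE => yp.
  have [yl|yl] := leqP y (part (lam k') n.+1); first by left.
  right; move: yp; case: eqP => [kE|] /=; last by lia.
  case: eqP => [nE|] /=; last by lia.
  by subst=> yp; congr (_, _, _); lia.
case=> [[]|[-> -> ->]].
  by case: n => // n _ y1 yp; split=> //; rewrite partE; lia.
by split=> //; rewrite partE !eqxx addn1.
Qed.

(** Pair the removable node of row i with the addable node of row i + 1: both are
absent exactly when the two rows have equal length, and in that case the two
beads are adjacent, so that their contributions to the right-hand side cancel
as well. The term at l = 0 comes from the bead 0 of the last row. *)
Lemma hub_row e (p : Defs.partition) c (l : Zmod e) : (size p < c)%N ->
  (\sum_(i < c) ((part p i.+2 < part p i.+1)%N && (cl e (bead p c i)%:Z == l))%:Z)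
  - \sum_(i < c) (((i == 0 :> nat) || (part p i.+1 < part p i)%N)
               && (cl e (bead p c i).+1%:Z == l))%:Z
  = (runner p c l)%:Z - (runner p c (l - cl e 1))%:Z - (l == 0%R)%:Z :> int.
Proof.
case: c => // c; rewrite ltnS => szp.
have lastp : part p c.+1 = 0%N by rewrite part_big.
have nextp : part p c.+2 = 0%N by rewrite part_big // ltnW.
have last0 : bead p c.+1 c = 0%N by rewrite /bead lastp subnn.
have prevE (x : nat) : (cl e x%:Z == l - cl e 1) = (cl e x.+1%:Z == l).
  by rewrite -[x.+1]addn1 PoszD clD eq_sym subr_eq eq_sym.
rewrite /runner /bead_sum; under [X in _ - X%:Z - _]eq_bigr do rewrite prevE.
rewrite !(raddf_sum Posz) /=.
rewrite big_ord_recr [X in _ - X = _]big_ord_recl /= nextp lastp ltnn addr0.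
rewrite [X in _ = X - _ - _]big_ord_recr [X in _ = _ - X - _]big_ord_recl /=.
rewrite last0 cl0 (eq_sym 0 l).
(* The last row has no removable node and the first one always has an addable
   node; the identity is left for the other, paired, rows. *)
suff -> : \sum_(i < c) ((part p i.+2 < part p i.+1)%N
              && (cl e (bead p c.+1 i)%:Z == l))%:Z
   = \sum_(i < c) ((part p (bump 0 i).+1 < part p (bump 0 i))%N
               && (cl e (bead p c.+1 (bump 0 i)).+1%:Z == l))%:Z
   + \sum_(i < c) (cl e (bead p c.+1 i)%:Z == l)%:Z
   - \sum_(i < c) (cl e (bead p c.+1 (bump 0 i)).+1%:Z == l)%:Z by ring.
rewrite -big_split -sumrB; apply: eq_bigr => i _ /=.
rewrite /bump /= add1n; case: ltnP => [_|le]; first by rewrite !andTb; ring.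
have -> : (bead p c.+1 i.+1).+1 = bead p c.+1 i.
  by have := part_leS p i; have := ltn_ord i; rewrite /bead; lia.
by ring.
Qed.

(** Deleting an l-node moves a bead from runner l to runner l - 1, and adding one
moves a bead back; so the difference of their numbers compares the two
runners. *)
Lemma hub_runners e r (a : 'I_r -> Zmod e) lam c l : charge_for a lam c ->
  hub a lam l = (runners lam c l)%:Z - (runners lam c (l - cl e 1))%:Z
                - r%:Z * (l == 0%R)%:Z.
Proof.
move=> ca; rewrite ffunE.
rewrite (@count_res_rows _ _ _ _ _ c (fun k i =>
  if (part (lam k) i.+2 < part (lam k) i.+1)%N then [:: part (lam k) i.+1] else [::])).
- rewrite (@count_res_rows _ _ _ _ _ c (fun k i =>
    if (i == 0)%N || (part (lam k) i.+1 < part (lam k) i)%N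
    then [:: (part (lam k) i.+1).+1] else [::])).
  + rewrite /runners !(raddf_sum Posz) /= -sumrB -!sumrB.
    have -> : r%:Z * (l == 0%R)%:Z = \sum_(k < r) (l == 0%R)%:Z.
      by rewrite sumr_const card_ord -mulr_natl natz.
    rewrite -sumrB; apply: eq_bigr => k _; have [ck sk] := ca k.
    rewrite -(hub_row l sk) !(raddf_sum Posz); congr (_ - _).
      apply: eq_bigr => i _; case: ifP => _; last by rewrite big_nil.
      by rewrite big_seq1 (residue_row _ ck).
    apply: eq_bigr => i _; case: ifP => _; last by rewrite big_nil.
    by rewrite big_seq1 (residue_row _ ck).
  + by move=> k i; case: ifP.
  + move=> i j k; split.
      case/addableP => i' [-> -> hi]; exists i' => //; rewrite hi inE eqxx andbT.
      have [_ sk] := ca k; case/orP: hi => [/eqP->|hi]; first by lia.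
      rewrite ltnNge; apply/negP => h; move: hi; rewrite (@part_big _ i') //.
      exact: leq_trans sk h.
    case=> i' -> /andP[ic]; case: ifP => // hi; rewrite inE => /eqP ->.
    by apply/addableP; exists i'.
- by move=> k i; case: ifP.
- move=> i j k; split.
    case/removableP => i' [-> -> hi]; exists i' => //; rewrite hi inE eqxx andbT.
    have [_ sk] := ca k.
    rewrite ltnNge; apply/negP => h; move: hi; rewrite (@part_big _ i'.+1) //.
    by apply: leq_trans sk _; exact: leq_trans h _.
  case=> i' -> /andP[ic]; case: ifP => // hi; rewrite inE => /eqP ->.
  by apply/removableP; exists i'.
Qed.

(** * The weight in terms of the abacus *)

Lemma res_upto_succ e (l : Zmod e) x :
  (res_upto l x + (l + cl e 1 == 0)%R = res_upto (l + cl e 1)%R x + (cl e x%:Z == l))%N.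
Proof.
rewrite /res_upto big_nat_recr //= [X in (_ = X + _)%N]big_nat_recl //= cl0.
under [X in (_ = _ + X + _)%N]eq_bigr => z _.
  rewrite -[z.+1]addn1 PoszD clD (inj_eq (addIr _)); over.
by rewrite (eq_sym 0) -addnA [RHS]addnAC [RHS]addnC [X in (_ + X)%N]addnC.
Qed.

Lemma charge_for_empty e r (a : 'I_r -> Zmod e) lam c :
  charge_for a lam c -> charge_for a (empty_mp r) c.
Proof. by move=> ca k; have [ck sk] := ca k; split=> //=; lia. Qed.

Lemma charge_for_addM e r (a : 'I_r -> Zmod e) (lam : multipartition r)
    (n : 'I_r -> nat) : (0 < e)%N ->
  (forall k, size (lam k) < e * n k)%N ->
  charge_for a lam (fun k => a k + e * n k)%N.
Proof.
move=> e0 szn k; split; first by rewrite cl_addM // cl_val.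
exact: leq_trans (szn k) (leq_addl _ _).
Qed.

Lemma charge_exists e r (a : 'I_r -> Zmod e) lam : (0 < e)%N ->
  exists c, charge_for a lam c.
Proof.
move=> e0; exists (fun k => a k + e * (size (lam k)).+1)%N.
by apply: charge_for_addM => // k; nia.
Qed.

(** Each l-node added to the empty diagram moves a bead from runner l - 1 to
runner l. *)
Lemma content_step e r (a : 'I_r -> Zmod e) lam c l : charge_for a lam c ->
  (content a lam l)%:Z - (content a lam (l + cl e 1))%:Z =
  (runners lam c l)%:Z - (runners (empty_mp r) c l)%:Z.
Proof.
move=> ca; have := content_beads l ca; have := content_beads (l + cl e 1) ca.
have stepE (mu : multipartition r) :
    (\sum_k bead_sum (res_upto l) (mu k) (c k) + \sum_k (c k) * (l + cl e 1 == 0)%R =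
    \sum_k bead_sum (res_upto (l + cl e 1)%R) (mu k) (c k) + runners mu c l)%N.
  rewrite /runners -!big_split; apply: eq_bigr => k _ /=.
  rewrite /runner /bead_sum -big_split /= -(eq_bigr _ (fun i _ => res_upto_succ l _)).
  by rewrite big_split sum_nat_const card_ord.
have := stepE lam; have := stepE (empty_mp r); rewrite /empty_mp; lia.
Qed.

Lemma hub_content e r (a : 'I_r -> Zmod e) lam : (0 < e)%N ->
  hub a lam - hub a (empty_mp r) = \sum_i alpha i *+ content a lam i.
Proof.
move=> e0; have [c ca] := charge_exists a lam e0.
apply/ffunP => l; rewrite sum_alphaE.
rewrite [LHS]ffunE [X in _ + X]ffunE !(hub_runners l ca) (hub_runners l (charge_for_empty ca)).
have := content_step l ca; have := content_step (l - cl e 1) ca; rewrite subrK; lia.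
Qed.

Lemma bead_sum_fibre e (g : Zmod e -> int) (p : Defs.partition) c :
  \sum_(i < c) g (cl e (bead p c i)%:Z) = \sum_l g l * (runner p c l)%:Z.
Proof.
rewrite /runner /bead_sum.
transitivity (\sum_(i < c) \sum_l (cl e (bead p c i)%:Z == l)%:R * g l).
  by apply: eq_bigr => i _; rewrite sum_delta.
rewrite exchange_big; apply: eq_bigr => l _; rewrite (raddf_sum Posz) /= mulr_sumr.
by apply: eq_bigr => i _; rewrite mulrC natz.
Qed.

(** Since c_k is congruent to a_k, telescoping along 0, 1, ..., c_k - 1 expresses
the content at a_k by the content at 0 and the differences P_l - P0_l; these
positions are exactly the beads of the empty partition. *)
Lemma weight_runners e r (a : 'I_r -> Zmod e) lam c : (0 < e)%N ->
  charge_for a lam c ->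
  2 * weight a lam =
  (2 * r%:Z * (content a lam 0)%:Z
   - \sum_(l : Zmod e) ((runners lam c l)%:Z ^+ 2 - (runners (empty_mp r) c l)%:Z ^+ 2))%:~R.
Proof.
move=> e0 ca.
pose cn (l : Zmod e) : int := content a lam l.
pose d (l : Zmod e) : int := (runners lam c l)%:Z - (runners (empty_mp r) c l)%:Z.
have dE l : d l = cn l - cn (l + cl e 1) by rewrite /d -(content_step l ca).
(* z runs through the integers, so no representative of a residue has to be
   chosen. *)
have tele (z : nat) : cn (cl e z) = cn 0 - \sum_(y < z) d (cl e y).
  elim: z => [|z IHz]; first by rewrite big_ord0 cl0 subr0.
  rewrite big_ord_recr /= opprD addrA -IHz dE -addn1 PoszD clD; ring.
have sum_c : \sum_k cn (a k) = r%:Z * cn 0 - \sum_l d l * (runners (empty_mp r) c l)%:Z.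
  transitivity (\sum_(k < r) (cn 0 - \sum_l d l * (runner empty_partition (c k) l)%:Z)).
    apply: eq_bigr => k _; have [<- _] := ca k; rewrite tele -bead_sum_fibre.
    congr (_ - _); rewrite (reindex_inj rev_ord_inj); apply: eq_bigr => i _ /=.
    by rewrite /bead part_empty.
  rewrite sumrB sumr_const card_ord -mulr_natl natz; congr (_ - _).
  rewrite exchange_big; apply: eq_bigr => l _.
  by rewrite /runners (raddf_sum Posz) /= mulr_sumr.
have sum_d : \sum_(i : Zmod e) (cn i - cn (i - cl e 1)) ^+ 2 = \sum_l d l ^+ 2.
  rewrite (reindex_inj (addIr (cl e 1))); apply: eq_bigr => l _ /=.
  by rewrite addrK dE -sqrrN opprB.
have -> : 2 * weight a lam =
    (2 * \sum_k cn (a k) - \sum_(i : Zmod e) (cn i - cn (i - cl e 1)) ^+ 2)%:~R.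
  rewrite /weight rmorphB rmorphM /= mulrBr mulrA divff // mul1r.
  rewrite !rmorph_sum /=; congr (_ * _ - _).
  by apply: eq_bigr => i _; rewrite rmorphXn rmorphB.
congr _%:~R; rewrite sum_c sum_d mulrBr mulrA -addrA; congr (_ + _).
rewrite -opprD; congr (- _); rewrite mulr_sumr -big_split; apply: eq_bigr => l _ /=.
rewrite /d; ring.
Qed.

(** * Cores on the abacus *)

Definition beads (p : Defs.partition) (c : nat) : seq nat :=
  [seq bead p c i | i <- iota 0 c].

Lemma bead_lt p c i j : (i < j < c)%N -> (bead p c j < bead p c i)%N.
Proof.
move=> ijc; have : (part p j.+1 <= part p i.+1)%N by apply: part_le; lia.
by rewrite /bead; lia.
Qed.

Lemma beads_uniq p c : uniq (beads p c).
Proof.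
rewrite map_inj_in_uniq ?iota_uniq // => i j; rewrite !mem_iota /= => ic jc ij.
by have [lt|lt|//] := ltngtP i j; have := @bead_lt p c; [move/(_ i j)|move/(_ j i)]; lia.
Qed.

Lemma bead_sumE F p c : bead_sum F p c = (\sum_(x <- beads p c) F x)%N.
Proof. by rewrite big_map -[iota 0 c](_ : index_iota 0 c = _) ?big_mkord // /index_iota subn0. Qed.

(** Shifting by D replaces the charge by the natural number c; the rows after
the c-th give exactly the negative elements of the translated set. *)
Lemma beta_setP r (ahat : 'I_r -> int) (lam : multipartition r) k (D : int) c b :
  ahat k + D = c%:Z -> (size (lam k) <= c)%N ->
  beta_set ahat lam k b <->
  (b + D < 0 \/ exists2 x : nat, x \in beads (lam k) c & b + D = x).
Proof.
move=> cE sc; split.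
  case=> -[//|i] _ bE; have [ic|ci] := ltnP i c.
    right; exists (bead (lam k) c i); last by rewrite /bead; lia.
    by apply/mapP; exists i => //; rewrite mem_iota.
  by left; rewrite bE part_big //; lia.
case=> [b0|[x /mapP[i]]].
  pose n := `|(b + D)%R|%N; exists (c + n)%N; first by lia.
  by rewrite part_big; lia.
by rewrite mem_iota /bead => /= ic -> bE; exists i.+1 => //; lia.
Qed.

(** All beads slide down: the multicore condition for one component, stated on
the natural beads only. *)
Definition core_shape e (p : Defs.partition) (c : nat) : Prop :=
  forall x, (x + e)%N \in beads p c -> x \in beads p c.

(** The condition on beads whose lower neighbour is negative holds trivially,
and changing the charge only translates the beta-set. *)
Lemma multicore_shape e r (a : 'I_r -> Zmod e) lam c : charge_for a lam c ->
  multicore a lam <-> forall k, core_shape e (lam k) (c k).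
Proof.
move=> ca; split.
  move=> mc k x xe; have [_ /ltnW sk] := ca k.
  have mcc : multicharge a (fun k => (c k)%:Z) by move=> j; have [] := ca j.
  have cE : (c k)%:Z + 0 = c k by rewrite addr0.
  apply: contrapT => xk; apply: (mc _ mcc); exists (x + e)%N%:Z, k.
  split; first by apply/(beta_setP _ cE sk); right; exists (x + e)%N; rewrite ?addr0.
  move/(beta_setP _ cE sk) => [|[y yk]]; first by lia.
  by move=> yE; apply: xk; rewrite (_ : x = y) //; lia.
move=> sh ahat _ [b [k []]]; have [_ /ltnW sk] := ca k.
have cE : ahat k + ((c k)%:Z - ahat k) = c k by rewrite subrKC.
move/(beta_setP _ cE sk) => bk nbk; apply: nbk; apply/(beta_setP _ cE sk).
case: bk => [|[x xk bE]]; first by left; lia.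
have [xe|ex] := ltnP x e; first by left; lia.
right; exists (x - e)%N; last by lia.
by apply: sh; rewrite subnK.
Qed.

Lemma perm_downclosed (s : seq nat) : uniq s ->
  (forall q, q.+1 \in s -> q \in s) -> perm_eq s (iota 0 (size s)).
Proof.
move=> us down; have down_le q m : (m <= q)%N -> q \in s -> m \in s.
  by move/subnK <-; elim: (q - m)%N => // d IHd /down.
rewrite perm_sym; apply: uniq_perm; rewrite ?iota_uniq //.
have sub : {subset iota 0 (size s) <= s}.
  move=> m; rewrite mem_iota add0n /= => ms; apply: contrapT => /negP nm.
  have : {subset s <= iota 0 m}.
    move=> q qs; rewrite mem_iota /= ltnNge; apply/negP => mq.
    by move/negP: nm; apply; exact: down_le qs.
  by move/(uniq_leq_size us); rewrite size_iota leqNgt ms.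
by have [] := uniq_min_size (iota_uniq 0 (size s)) sub _; rewrite ?size_iota.
Qed.

Section CoreShape.
Variables (e : nat) (p : Defs.partition) (c : nat).
Hypotheses (e0 : (0 < e)%N) (sh : core_shape e p c).

(** Without gaps, the beads on a runner occupy its lowest positions. *)
Lemma runner_iota (l : Zmod e) :
  perm_eq [seq (x %/ e)%N | x <- beads p c & cl e x%:Z == l]
          (iota 0 (runner p c l)).
Proof.
have xE (x : nat) : cl e x%:Z == l -> x = (x %/ e * e + l)%N.
  by move/eqP <-; rewrite val_cl_nat // -divn_eq.
have le : (l < e)%N by rewrite -[e in (_ < e)%N]prednK.
rewrite -[X in iota 0 X](_ : size [seq (x %/ e)%N | x <- beads p c & cl e x%:Z == l] = _).
  apply: perm_downclosed.
    rewrite map_inj_in_uniq ?filter_uniq ?beads_uniq // => x y.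
    rewrite !mem_filter => /andP[/xE xE' _] /andP[/xE yE _] xy.
    by rewrite xE' xy -yE.
  move=> q /mapP[x]; rewrite mem_filter => /andP[xl xb qE]; apply/mapP.
  exists (q * e + l)%N; last by rewrite divnMDl // divn_small ?addn0.
  rewrite mem_filter PoszD clD -{2}(add0r l) cl_val // (inj_eq (addIr _)).
  rewrite cl_eq0 // dvdzE /= dvdn_mull //=.
  apply: sh; rewrite (_ : (q * e + l + e)%N = x) //.
  by rewrite (xE _ xl) -qE mulSn; lia.
rewrite size_map size_filter -sum1_count big_mkcond /runner bead_sumE.
by apply: eq_bigr => x _; case: eqP.
Qed.

Lemma core_mem (x : nat) : (x \in beads p c) = (x %/ e < runner p c (cl e x%:Z))%N.
Proof.
have := perm_mem (runner_iota (cl e x%:Z)) (x %/ e)%N; rewrite mem_iota /= add0n => <-.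
apply/idP/mapP => [xb|[y]]; first by exists x => //; rewrite mem_filter eqxx.
rewrite mem_filter -val_eqE /= !val_cl_nat // => /andP[/eqP ym yb] xy.
by rewrite (divn_eq x e) xy -ym -divn_eq.
Qed.

Lemma res_upto0 (x : nat) : res_upto (0 : Zmod e) x = (x %/ e)%N.+1.
Proof.
rewrite /res_upto; elim: x => [|x IHx]; first by rewrite big_nat1 cl0 eqxx div0n.
by rewrite big_nat_recr //= IHx divnS // cl_eq0 // dvdzE addSn addnC.
Qed.

(** The bead in position q of its runner contributes q + 1 to the left-hand sum,
so a runner with p beads contributes p (p + 1) / 2. *)
Lemma core_energy :
  (2 * bead_sum (res_upto (0%R : Zmod e)) p c =
   \sum_(l : Zmod e) runner p c l * (runner p c l).+1)%N.
Proof.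
rewrite bead_sumE.
transitivity (2 * \sum_(l : Zmod e) \sum_(x <- beads p c)
    if cl e x%:Z == l then (x %/ e).+1 else 0)%N.
  rewrite exchange_big //=; congr (2 * _)%N; apply: eq_bigr => x _.
  by rewrite res_upto0 -big_mkcond (big_pred1 (cl e x%:Z)) // => l; rewrite eq_sym.
rewrite big_distrr; apply: eq_bigr => l _ /=.
rewrite -big_mkcond -big_filter -(big_map (fun x => x %/ e)%N xpredT S).
rewrite (perm_big _ (runner_iota l)) /=.
elim: (runner p c l) => [|n IHn]; first by rewrite big_nil.
have -> : iota 0 n.+1 = iota 0 n ++ [:: n] by rewrite -addn1 iotaD.
by rewrite big_cat mulnDr IHn big_seq1; lia.
Qed.

End CoreShape.

(** * The abacus of the empty multipartition and of a core block *)

Lemma bead_empty c i : bead empty_partition c i = (c - i.+1)%N.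
Proof. by rewrite /bead part_empty. Qed.

Lemma bead_sum_empty F c : bead_sum F empty_partition c = (\sum_(i < c) F i)%N.
Proof.
rewrite /bead_sum (reindex_inj rev_ord_inj); apply: eq_bigr => i _ /=.
by rewrite bead_empty; congr F; have := ltn_ord i; lia.
Qed.

Lemma runner_emptyS e c (l : Zmod e) :
  runner empty_partition c.+1 l =
  (runner empty_partition c l + (cl e c%:Z == l))%N.
Proof. by rewrite /runner !bead_sum_empty big_ord_recr. Qed.

Lemma runner_empty_mono e c d (l : Zmod e) : (c <= d)%N ->
  (runner empty_partition c l <= runner empty_partition d l)%N.
Proof.
move/subnK <-; elim: (d - c)%N => // n IHn.
by rewrite addSn runner_emptyS; lia.
Qed.

(** The positions c, ..., c + e - 1 meet every residue class once. *)
Lemma runner_empty_period e c (l : Zmod e) : (0 < e)%N ->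
  runner empty_partition (c + e) l = (runner empty_partition c l).+1.
Proof.
case: e l => // e l _; rewrite /runner !bead_sum_empty big_split_ord /=.
rewrite -[RHS]addn1; congr addn.
transitivity (\sum_(i : Zmod e.+1) ((l - cl e.+1 c%:Z)%R == i))%N.
  apply: eq_bigr => i _.
  by rewrite PoszD clD cl_val // subr_eq addrC eq_sym.
rewrite (bigD1 (l - cl e.+1 c%:Z)) //= eqxx big1 // => i.
by rewrite eq_sym => /negbTE ->.
Qed.

Lemma runner_total e (p : Defs.partition) c :
  (\sum_(l : Zmod e) runner p c l = c)%N.
Proof.
have := @bead_sum_fibre e (fun=> 1) p c.
rewrite sumr_const card_ord natz => E; apply/eqP; rewrite -eqz_nat E (raddf_sum Posz) /=.
by apply/eqP; apply: eq_bigr => l _; rewrite mul1r.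
Qed.

Lemma core_shape_empty e c : core_shape e empty_partition c.
Proof.
move=> x /mapP[i]; rewrite mem_iota bead_empty => /= ic xE.
by apply/mapP; exists (c - x.+1)%N; rewrite ?mem_iota ?bead_empty; lia.
Qed.

Lemma max_int_eq (A : set int) b : A b -> (forall b', A b' -> b' <= b) ->
  max_int A = b.
Proof.
move=> Ab ub; rewrite /max_int; apply: xget_unique => // b' [Ab' ub'].
by apply: le_anti; rewrite ub //= ub'.
Qed.

(** On a runner l of a core with p beads, the positions l, l + e, ... up to
l + e (p - 1) are filled; when p = 0, the last bead is the negative position
l - e. *)
Lemma top_beta_runner e r (ahat : 'I_r -> int) (lam : multipartition r) k D c
    (l : Zmod e) : (0 < e)%N ->
  ahat k + D = c%:Z -> cl e D = 0 -> (size (lam k) <= c)%N ->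
  core_shape e (lam k) c ->
  top_beta ahat lam l k = l%:Z + e%:Z * ((runner (lam k) c l)%:Z - 1) - D.
Proof.
move=> e0 cE D0 sc sh; set p := runner (lam k) c l.
have le : (l < e)%N by rewrite -[e in (_ < e)%N]prednK.
have betaE := beta_setP (lam := lam) _ cE sc.
have resE b : cl e (b + D) = cl e b by rewrite clD D0 addr0.
apply: max_int_eq.
  split; last first.
    rewrite /= clB D0 subr0 clD cl_val // -[RHS]addr0; congr (_ + _).
    by apply/eqP; rewrite cl_eq0 // dvdz_mulr.
  apply/betaE; rewrite subrK; case pE : p => [|q]; first by left; nia.
  right; exists (q * e + l)%N; last by lia.
  rewrite (core_mem e0 sh) divnMDl // divn_small // addn0.
  rewrite PoszD clD cl_val // (_ : cl e _ = 0) ?add0r -/p ?pE //.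
  by apply/eqP; rewrite cl_eq0 // dvdzE /= dvdn_mull.
move=> b [/betaE bb /= bl]; rewrite lerBrDr.
case: bb => [b0|[x xb bE]].
  have [m [mE m0]] : exists m : int, b + D = l%:Z + e%:Z * m /\ m < 0.
    have : (e%:Z %| b + D - l%:Z)%Z by rewrite -cl_eq0 // clB resE bl cl_val // subrr.
    case/dvdzP => m mE; exists m; split; first by lia.
    by nia.
  by rewrite mE; nia.
move: xb; rewrite (core_mem e0 sh).
have -> : cl e x%:Z = l by rewrite -bE resE.
rewrite -/p bE => xp.
have -> : x = (x %/ e * e + l)%N.
  rewrite {1}(divn_eq x e); congr addn; rewrite -val_cl_nat //.
  by rewrite -bE resE bl.
by rewrite -/p; nia.
Qed.

(** Translating all charges by one common large multiple of e changes all top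
beads by the same amount and keeps the property defining core blocks. *)
Lemma core_charge e r (a : 'I_r -> Zmod e) lam ahat (b : Zmod e -> int) :
  (0 < e)%N -> multicore a lam -> multicharge a ahat ->
  (forall i j, top_beta ahat lam i j = b i \/ top_beta ahat lam i j = b i + e%:Z) ->
  exists c, [/\ charge_for a lam c, forall k, core_shape e (lam k) (c k) &
    forall l : Zmod e, balanced (fun k => runner (lam k) (c k) l)].
Proof.
move=> e0 mc mch top.
(* One translation serves all components, so that the numbers b_i are all
   replaced by b_i + e K. *)
pose K := (\sum_k (`|ahat k|%N + (size (lam k)).+1))%N.
have Kk k : (`|ahat k|%N + (size (lam k)).+1 <= K)%N by rewrite /K (bigD1 k) //= leq_addr.
pose c k := `|(ahat k + (e * K)%N%:Z)%R|%N.
have cE k : ahat k + (e * K)%N%:Z = c k by rewrite /c; have := Kk k; nia.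
have D0 : cl e (e * K)%N%:Z = 0 by apply/eqP; rewrite cl_eq0 // dvdzE /= dvdn_mulr.
have ca : charge_for a lam c.
  move=> k; split; first by rewrite -cE clD D0 addr0 mch.
  by have := Kk k; have := cE k; nia.
have sh := (multicore_shape ca).1 mc.
exists c; split=> // l j k.
have sz k' : (size (lam k') <= c k')%N by have [_ /ltnW] := ca k'.
have := top l j; have := top l k.
rewrite !(top_beta_runner _ e0 (cE _) D0 (sz _) (sh _)); nia.
Qed.

(** * Cores with a prescribed abacus *)

(** The part of row i + 1 is the excess of the i-th largest bead over the bead
of an empty row; 0 being a bead makes the last part vanish. *)
Lemma partition_of_beads (X : seq nat) : sorted gtn X -> 0%N \in X ->
  exists2 p : Defs.partition, (size p < size X)%N & beads p (size X) = X.
Proof.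
move=> sX X0; set c := size X.
have c0 : (0 < c)%N by rewrite /c; case: (X) X0.
have dec i : (i.+1 < c)%N -> (nth 0 X i.+1 < nth 0 X i)%N.
  by move=> ic; move/(sortedP 0%N): sX => /(_ _ ic).
(* The beads decrease strictly to a natural number. *)
have low i : (i < c)%N -> (c - i.+1 <= nth 0 X i)%N.
  move=> ic; have [n nE] : exists n, n = (c - i.+1)%N by eexists.
  rewrite -nE; elim: n i ic nE => // n IHn i ic nE.
  by have := dec i; have := IHn i.+1; lia.
pose f i := (nth 0 X i - (c - i.+1))%N.
have f_dec i : (f i.+1 <= f i)%N.
  rewrite /f; have [ic|ci] := ltnP i.+1 c; last by rewrite [nth 0 X i.+1]nth_default.
  by have := dec i ic; lia.
have fM : f c.-1 = 0%N.
  have /(nthP 0%N)[j jc j0] := X0; rewrite -/c in jc.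
  have [jl|] := ltnP j.+1 c; first by have := dec j jl; rewrite j0.
  by move=> cj; rewrite /f (_ : c.-1 = j) ?j0 //; lia.
exists (mkpart c.-1 f_dec); first by have := size_mkpart c.-1 f_dec; lia.
apply: (@eq_from_nth _ 0%N); rewrite /beads size_map size_iota // => i ic.
rewrite (nth_map 0%N) ?size_iota // nth_iota // add0n /bead part_mkpart // /f.
by have := low i ic; lia.
Qed.

Lemma count_runner e (l : Zmod e) m n : (0 < e)%N ->
  (\sum_(x < n * e) ((x %/ e < m) && (cl e x%:Z == l)) = minn m n)%N.
Proof.
move=> e0; elim: n => [|n IHn]; first by rewrite mul0n big_ord0 minn0.
rewrite mulSnr big_split_ord /= IHn.
rewrite (_ : (\sum_(i < e) _)%N = (n < m)%N); first by case: ltnP; lia.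
case: e e0 l {IHn} => // e _ l.
transitivity (\sum_(i : Zmod e.+1) ((n < m) && (l == i)))%N.
  apply: eq_bigr => i _; rewrite divnMDl // divn_small // addn0 PoszD clD cl_val //.
  rewrite (_ : cl _ _ = 0) ?add0r 1?eq_sym //.
  by apply/eqP; rewrite cl_eq0 // dvdzE /= dvdn_mull.
rewrite (bigD1 l) //= eqxx andbT big1 ?addn0 // => i.
by rewrite eq_sym => /negbTE ->; rewrite andbF.
Qed.

(** Fill the lowest p l positions of each runner l. *)
Lemma core_exists e (p : Zmod e -> nat) : (0 < e)%N -> (0 < p 0%R)%N ->
  let c := (\sum_l p l)%N in
  exists lam : Defs.partition, [/\ (size lam < c)%N, core_shape e lam c &
    forall l, runner lam c l = p l].
Proof.
move=> e0 p0 c.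
have pc l : (p l <= c)%N by rewrite /c (bigD1 l) //= leq_addr.
pose X := rev [seq x <- iota 0 (c * e) | x %/ e < p (cl e x%:Z)]%N.
have inX x : (x \in X) = (x %/ e < p (cl e x%:Z))%N.
  rewrite mem_rev mem_filter mem_iota /=; case: ltnP => //= lt.
  rewrite add0n -ltn_divLR //; exact: leq_trans lt (pc _).
have sX : sorted gtn X.
  rewrite rev_sorted; apply: sorted_filter; last exact: iota_ltn_sorted.
  by move=> x y z /=; exact: ltn_trans.
have X0 : 0%N \in X by rewrite inX div0n cl0.
have [lam szl lamE] := partition_of_beads sX X0.
have run l : runner lam (size X) l = p l.
  rewrite /runner bead_sumE lamE (perm_big _ (permEl (perm_rev _))) big_filter.
  have /minn_idPl pE := pc l; rewrite -[RHS]pE -(count_runner l (p l) c e0).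
  rewrite -(big_mkord xpredT (fun x => (x %/ e < p l)%N && (cl e x%:Z == l) : nat)).
  rewrite /index_iota subn0 big_mkcond; apply: eq_bigr => x _.
  by case: eqP => [->|_]; rewrite ?andbT ?andbF //; case: ltnP.
have sE : size X = c by rewrite -(@runner_total e lam (size X)); apply: eq_bigr => l _; rewrite run.
exists lam; rewrite -sE; split=> // x; rewrite lamE !inX.
have -> : cl e (x + e)%N%:Z = cl e x%:Z by rewrite -[X in (x + X)%N]muln1 cl_addM.
by rewrite divnDr ?dvdnn // divnn e0; lia.
Qed.

(** A balanced row takes at most the two values floor(P_l / r) and
floor(P_l / r) + 1, which give the numbers b_l of the definition of a core
block. *)
Lemma core_block_exists e r (a : 'I_r -> Zmod e) (p : Zmod e -> 'I_r -> nat)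
    (c : 'I_r -> nat) : (0 < e)%N -> (0 < r)%N ->
  (forall k, cl e (c k)%:Z = a k) -> (forall k, \sum_l p l k = c k)%N ->
  (forall k, 0 < p 0%R k)%N -> (forall l, balanced (p l)) ->
  exists lam, [/\ charge_for a lam c,
    core_block a [set mu | content a mu = content a lam] &
    forall l, runners lam c l = (\sum_k p l k)%N].
Proof.
move=> e0 r0 ac pc p0 bal.
have /choice[lam lamP] k := core_exists (p := p^~ k) e0 (p0 k).
have ca : charge_for a lam c by move=> k; split=> //; have [] := lamP k; rewrite pc.
have sh k : core_shape e (lam k) (c k) by have [] := lamP k; rewrite pc.
have run k l : runner (lam k) (c k) l = p l k by have [_ _] := lamP k; rewrite pc => ->.
exists lam; split=> // [|l]; last by apply: eq_bigr => k _; exact: run.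
split; first by exists lam.
exists lam; split=> //; first by apply/(multicore_shape ca).
exists (fun k => (c k)%:Z), (fun l : Zmod e => l%:Z + e%:Z * (((\sum_k p l k)%N %/ r)%N%:Z - 1)).
split=> // l k; have [_ /ltnW sz] := ca k.
have cE : (c k)%:Z + 0 = c k by rewrite addr0.
rewrite (top_beta_runner _ e0 cE (cl0 _) sz (sh k)) run subr0.
have := balanced_divn r0 (bal l) k; move: (_ %/ r)%N (p l k) => q x /andP[qx xq].
have [->|->] : x = q \/ x = q.+1 by lia.
  by left.
by right; rewrite -[q.+1]addn1 PoszD; ring.
Qed.

(** * Potentials of hubs and the vectors t and v *)

(** A solution N of the equations that the bead counts P_l satisfy for the hub of
a multipartition; N is unique up to a constant. *)
Definition potential e r (theta : {ffun Zmod e -> int}) (N : Zmod e -> int) : Prop :=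
  forall l, theta l = N l - N (l - cl e 1) - r%:Z * (l == 0%R)%:Z.

(** Abel summation: the differences of N with the weights 1, ..., e - 1 sum to
all the values of N minus e times the value at i, and the exceptional term at
0 cancels r i. *)
Lemma tvec_potential e r theta N (i : Zmod e) : (0 < e)%N ->
  potential r theta N ->
  tvec r theta i = cl (e * r) (\sum_l N l - e%:Z * N i).
Proof.
move=> e0 pot; rewrite /tvec; congr cl.
(* u lists the values of N backwards from i; it closes up, u e = u 0. *)
pose u (x : nat) := N (i - cl e x%:Z).
have thetaE (x : nat) : theta (i - cl e x%:Z) =
    u x - u x.+1 - r%:Z * (i == cl e x%:Z)%:Z.
  by rewrite pot /u -[x.+1]addn1 PoszD clD opprD addrA subr_eq0.
have abel (n : nat) : \sum_(1 <= x < n.+1) x%:Z * (u x - u x.+1) =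
    \sum_(1 <= x < n.+1) u x - n%:Z * u n.+1.
  elim: n => [|n IHn]; first by rewrite !big_geq // mul0r subrr.
  rewrite big_nat_recr //= [X in _ = X - _]big_nat_recr //= IHn.
  have -> : n.+1%:Z = n%:Z + 1 by rewrite -PoszD addn1.
  by ring.
have ind : \sum_(1 <= x < e) x%:Z * (i == cl e x%:Z)%:Z = i%:Z.
  case: e e0 i {N theta pot u thetaE abel} => // e _ i.
  transitivity (\sum_(0 <= x < e.+1) x%:Z * (i == cl e.+1 x%:Z)%:Z).
    by rewrite [RHS]big_nat_recl // mul0r add0r big_add1.
  rewrite big_mkord (bigD1 i) //= cl_val // eqxx mulr1 big1 ?addr0 // => x xi.
  by rewrite cl_val // eq_sym (negbTE xi) mulr0.
have sumu : \sum_(0 <= x < e) u x = \sum_l N l.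
  case: e e0 i N {theta pot thetaE abel ind} @u => // e _ i N /=.
  rewrite big_mkord (reindex_inj (subrI i)); apply: eq_bigr => x _.
  by rewrite cl_val // opprB addrC subrK.
have ue : u e = N i by rewrite /u (_ : cl e e = 0) ?subr0 //; apply/eqP; rewrite cl_eq0.
have u0 : u 0%N = N i by rewrite /u cl0 subr0.
have -> : \sum_(1 <= x < e) x%:Z * theta (i - cl e x%:Z) =
    \sum_(1 <= x < e) x%:Z * (u x - u x.+1)
    - r%:Z * \sum_(1 <= x < e) x%:Z * (i == cl e x%:Z)%:Z.
  by rewrite mulr_sumr -sumrB; apply: eq_bigr => x _; rewrite thetaE; ring.
rewrite ind -sumu addrC subrK; have := abel e.-1; rewrite prednK // => ->.
rewrite [X in _ = X - _](big_ltn e0) ue u0.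
have -> : e%:Z = e.-1%:Z + 1 by rewrite -PoszD addn1 prednK.
by ring.
Qed.

Lemma cl_cl e n (z : int) : (0 < e)%N -> (0 < n)%N -> (e %| n)%N ->
  cl e (cl n z : nat)%:Z = cl e z.
Proof.
move=> e0 n0 en; apply/eqP; rewrite cl_eq //.
apply: (@dvdz_trans n%:Z); first by rewrite dvdzE.
by rewrite -cl_eq // cl_val.
Qed.

Section PotentialVectors.
Variables (e r C : nat) (theta : {ffun Zmod e -> int}) (N : Zmod e -> int).
Hypotheses (e0 : (0 < e)%N) (r0 : (0 < r)%N) (pot : potential r theta N)
  (NC : \sum_l N l = C%:Z).

Lemma potential_reduction : common_reduction r theta (C %% e).
Proof.
split=> [|i]; first exact: ltn_pmod.
rewrite modn_mod -!val_cl_nat // (tvec_potential i e0 pot) NC cl_cl ?muln_gt0 ?e0 ?dvdn_mulr //.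
rewrite clB [X in _ - X](_ : _ = 0) ?subr0 //.
by apply/eqP; rewrite cl_eq0 // dvdz_mulr.
Qed.

(** Writing C = h + e q, the condition defining v_j becomes
e (N_i - q - j) = 0 modulo e r. *)
Lemma potential_vvec j :
  vvec r (C %% e) theta j = \sum_i (r%:Z %| N i - (C %/ e)%N%:Z - j%:Z)%Z%:Z.
Proof.
rewrite ffunE -sum1_card big_mkcond (raddf_sum Posz) /=; apply: eq_bigr => i _.
rewrite inE (tvec_potential i e0 pot) NC -clB cl_eq ?muln_gt0 ?e0 //.
have -> : (C %% e)%N%:Z - (C%:Z - e%:Z * N i) - (e * j)%N%:Z =
    e%:Z * (N i - (C %/ e)%N%:Z - j%:Z).
  rewrite {2}(divn_eq C e) PoszD !PoszM; ring.
by rewrite PoszM dvdz_mul2l ?lt0n_neq0 //; case: ifP.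
Qed.

End PotentialVectors.

(** * The gap between two potentials *)

Section Gap.
Variables (I : finType) (r : nat) (P0 P : I -> nat).
Hypotheses (r0 : (0 < r)%N) (sumP : (\sum_i P0 i = \sum_i P i)%N).

(** With P0 and P the row sums for the empty multipartition and for a core, the
values at s < r are the coefficients of v(theta) - v(Theta) in the alpha_j. *)
Definition gap (s : nat) : int :=
  \sum_i ((low_sum r s (P0 i))%:Z - (low_sum r s (P i))%:Z).

Lemma gap0 : gap 0 = 0.
Proof. by rewrite /gap big1 // => i _; rewrite !low_sum0. Qed.

(** L_(s + r)(P) is L_s(P) + P + s, and the terms P + s cancel in total because P0
and P have the same sum. *)
Lemma gap_period s : gap (s + r) = gap s.
Proof.
have sumPZ : \sum_i (P0 i)%:Z = \sum_i (P i)%:Z.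
  by rewrite -!(raddf_sum Posz) /= sumP.
rewrite /gap (eq_bigr (fun i => ((P0 i)%:Z - (P i)%:Z)
    + ((low_sum r s (P0 i))%:Z - (low_sum r s (P i))%:Z))).
  by rewrite big_split /= [X in X + _]sumrB sumPZ subrr add0r.
by move=> i _; rewrite !low_sum_period //; lia.
Qed.

Lemma gap_mod s : gap s = gap (s %% r).
Proof.
rewrite {1}(divn_eq s r) addnC; elim: (s %/ r)%N => [|q IHq]; first by rewrite addn0.
by rewrite mulSnr addnA gap_period.
Qed.

Lemma gap_diff s :
  2 * gap s.+1 - gap s - gap s.+2 =
  \sum_i (r %| P i + s.+1)%N%:Z - \sum_i (r %| P0 i + s.+1)%N%:Z.
Proof.
rewrite /gap mulr_sumr -!sumrB; apply: eq_bigr => i _.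
by have := low_sum_diff s (P i) r0; have := low_sum_diff s (P0 i) r0; lia.
Qed.

End Gap.

Lemma smallest_set r (A : 'I_r -> nat) s : (s <= r)%N ->
  exists2 Y : {set 'I_r}, #|Y| = s &
    forall j k, j \in Y -> k \notin Y -> (A j <= A k)%N.
Proof.
elim: s => [_|s IHs sr].
  by exists (finset.set0) => [|j k]; rewrite ?cards0 // inE.
have [Y Ys small] := IHs (ltnW sr).
have [k0 k0Y] : exists k, k \notin Y.
  apply/existsP; rewrite -negb_forall; apply/negP => /forallP all.
  have : (#|'I_r| <= #|Y|)%N by apply: subset_leq_card; apply/fintype.subsetP => x _.
  by rewrite card_ord Ys; lia.
case: (@arg_minnP _ k0 (fun k => k \notin Y) A k0Y) => m mY mmin.
exists (m |: Y)%SET => [|j k]; first by rewrite cardsU1 mY Ys.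
rewrite !inE negb_or => /orP[/eqP ->|jY] /andP[_ kY]; first exact: mmin.
exact: small.
Qed.

Section VVec.
Variables (e r : nat) (Theta theta : {ffun Zmod e -> int}) (P0 P : Zmod e -> nat).
Hypotheses (e0 : (0 < e)%N) (r0 : (0 < r)%N)
  (pot0 : potential r Theta (fun l => (P0 l)%:Z))
  (pot : potential r theta (fun l => (P l)%:Z))
  (sumP : (\sum_i P0 i = \sum_i P i)%N)
  (gap_ge0 : forall s, (s < r)%N -> 0 <= gap r P0 P s).

Let C := (\sum_i P i)%N.
Let s_of (j : Zmod r) : Zmod r := - cl r (C %/ e)%N%:Z - j.

(** The coefficient of alpha_j is the value of the gap at the s < r for which
P_i + s is divisible by r exactly when i is counted by v_j. As j increases, s
decreases, cyclically; by periodicity the second difference of the gap at s is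
the j-th entry of v(theta) - v(Theta). *)
Lemma vvec_gap :
  let h := (C %% e)%N in
  exists m : {ffun Zmod r -> nat},
    [/\ vvec r h theta - vvec r h Theta = \sum_i alpha i *+ m i,
        exists j, m j = 0%N &
        (\sum_i m i)%N%:Z = \sum_(s < r) gap r P0 P s].
Proof.
move=> h.
pose m : {ffun Zmod r -> nat} := [ffun j => `|gap r P0 P (s_of j)|%N].
have mE j : (m j)%:Z = gap r P0 P (s_of j).
  by rewrite ffunE gez0_abs // gap_ge0 // -[r in (_ < r)%N]prednK.
have gapE (s t : nat) : cl r s%:Z = cl r t%:Z -> gap r P0 P s = gap r P0 P t.
  move=> /(congr1 val); rewrite /= !val_cl_nat // => st.
  by rewrite (gap_mod r0 sumP) st -gap_mod.
exists m; split.
- apply/ffunP => j; rewrite sum_alphaE !mE [LHS]ffunE [X in _ + X]ffunE.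
  (* The three arguments s, s + 1, s + 2 represent the values of s_of at j + 1, j
     and j - 1; adding r - 1 avoids a subtraction from 0. *)
  pose s := (s_of j + r.-1)%N.
  have clr : cl r r%:Z = 0 by apply/eqP; rewrite cl_eq0.
  have s1 : cl r s.+1%:Z = s_of j.
    have -> : s.+1 = (s_of j + r)%N by rewrite /s; lia.
    by rewrite PoszD clD clr addr0 cl_val.
  have sE : cl r s%:Z = s_of (j + cl r 1).
    by apply: (addIr (cl r 1)); rewrite -clS s1 /s_of opprD addrA subrK.
  have s2 : cl r s.+2%:Z = s_of (j - cl r 1).
    by rewrite clS s1 /s_of opprB addrA addrAC.
  rewrite (gapE (s_of j) s.+1) ?s1 ?cl_val //.
  rewrite (gapE (s_of (j + cl r 1)) s) ?sE ?cl_val //.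
  rewrite (gapE (s_of (j - cl r 1)) s.+2) ?s2 ?cl_val // gap_diff //.
  have NC : \sum_l (P l)%:Z = C%:Z by rewrite /C (raddf_sum Posz).
  have NC0 : \sum_l (P0 l)%:Z = C%:Z by rewrite /C -sumP (raddf_sum Posz).
  rewrite (potential_vvec e0 r0 pot NC) (potential_vvec e0 r0 pot0 NC0).
  have dvd (x : nat) : (r%:Z %| x%:Z - (C %/ e)%N%:Z - j%:Z)%Z = (r %| x + s.+1)%N.
    have -> : (r %| x + s.+1)%N = (cl r (x + s.+1)%N%:Z == 0) by rewrite cl_eq0.
    by rewrite -cl_eq0 // !clB cl_val // PoszD clD s1 /s_of addrA.
  by congr (_ - _); apply: eq_bigr => i _; rewrite dvd.
- exists (- cl r (C %/ e)%N%:Z); apply/eqP; rewrite -eqz_nat mE /s_of subrr.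
  by rewrite gap0.
- rewrite (raddf_sum Posz) /=; under eq_bigr do rewrite mE.
  have sumI (F : nat -> int) : \sum_(s < r) F s = \sum_(s : Zmod r) F s.
    by rewrite -[in LHS](prednK r0).
  by rewrite sumI [RHS](reindex_inj (h := s_of)) //; exact: subrI.
Qed.

End VVec.

(** * The weight of a core block *)

Lemma runners_total e r (mu : multipartition r) (c : 'I_r -> nat) :
  (\sum_(l : Zmod e) runners mu c l = \sum_k c k)%N.
Proof. by rewrite exchange_big; apply: eq_bigr => k _; exact: runner_total. Qed.

(** The bead counts of an empty partition are monotone in the charge and all
increase by 1 when e is added to it. *)
Lemma balanced_window e r (c : 'I_r -> nat) (l : Zmod e) : (0 < e)%N ->
  (forall j k, c j <= c k + e)%N ->
  balanced (fun k => runner empty_partition (c k) l).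
Proof.
move=> e0 window j k; rewrite -runner_empty_period //.
exact: runner_empty_mono.
Qed.

Section CoreWeight.
Variables (e r : nat) (a : 'I_r -> Zmod e) (lam : multipartition r) (c : 'I_r -> nat).
Hypotheses (e0 : (0 < e)%N) (r0 : (0 < r)%N) (ca : charge_for a lam c)
  (sh : forall k, core_shape e (lam k) (c k))
  (bal : forall l : Zmod e, balanced (fun k => runner (lam k) (c k) l)).

Let P (l : Zmod e) := runners lam c l.
Let P0 (l : Zmod e) := runners (empty_mp r) c l.

(** A charge is the total number of beads of its component. *)
Lemma core_window j k : (c j <= c k + e)%N.
Proof.
rewrite -[X in (X <= _)%N](@runner_total e (lam j)) -[X in (_ <= X + _)%N](@runner_total e (lam k)).
have sum1 : (\sum_(l : Zmod e) 1 = e)%N by rewrite sum_nat_const card_ord muln1 prednK.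
rewrite -[X in (_ <= _ + X)%N]sum1.
by rewrite -big_split leq_sum // => l _ /=; rewrite addn1; exact: bal.
Qed.

(** Let X consist of s components of smallest charge. Its columns have the same
total in both abaci. For the empty multipartition this total is the sum of the
L_s(P0_l), because the columns in X are the smallest in each row; for the core
it is at least the sum of the L_s(P_l). *)
Lemma core_gap_ge0 s : (s < r)%N -> 0 <= gap r P0 P s.
Proof.
move=> /ltnW sr; have [X Xs small] := smallest_set c sr.
rewrite /gap sumrB subr_ge0 -!(raddf_sum Posz) lez_nat -Xs.
have tot (mu : multipartition r) :
    (\sum_(k in X) c k = \sum_(l : Zmod e) \sum_(k in X) runner (mu k) (c k) l)%N.
  by rewrite exchange_big; apply: eq_bigr => k _; rewrite runner_total.
apply: (@leq_trans (\sum_(k in X) c k)).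
  by rewrite (tot lam) leq_sum // => l _; exact: (low_sum_le r0 (bal l)).
rewrite (tot (empty_mp r)) leq_sum // => l _.
rewrite (low_sum_smallest r0 (balanced_window l e0 core_window)) // => j k jX kX.
by apply: runner_empty_mono; exact: small.
Qed.

(** Apply [row_energy] to each row of both abaci. The linear terms cancel, since
the total number of beads is the same. *)
Lemma core_weight : weight a lam = (\sum_(s < r) gap r P0 P s)%:~R.
Proof.
apply: (@mulfI _ (2 : rat)) => //; rewrite (weight_runners e0 ca).
transitivity ((2 * \sum_(s < r) gap r P0 P s)%:~R : rat); last by rewrite rmorphM.
congr _%:~R.
have energy (mu : multipartition r) :
    (forall k, core_shape e (mu k) (c k)) ->
    (forall l : Zmod e, balanced (fun k => runner (mu k) (c k) l)) ->
    (r * (2 * \sum_k bead_sum (res_upto (0%R : Zmod e)) (mu k) (c k)) +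
      2 * \sum_(s < r) \sum_(l : Zmod e) low_sum r s (runners mu c l) =
     \sum_(l : Zmod e) runners mu c l ^ 2 + (2 * r).-1 * \sum_k c k)%N.
  move=> shm balm; rewrite big_distrr /=.
  rewrite (eq_bigr _ (fun k _ => core_energy e0 (shm k))) exchange_big /=.
  rewrite [in X in (_ + X)%N]exchange_big -(@runners_total e _ mu) !big_distrr -!big_split /=.
  by apply: eq_bigr => l _; exact: (row_energy r0 (balm l)).
have -> : \sum_(s < r) gap r P0 P s =
    (\sum_(s < r) \sum_l low_sum r s (P0 l))%N%:Z
    - (\sum_(s < r) \sum_l low_sum r s (P l))%N%:Z.
  rewrite !(raddf_sum Posz) -sumrB; apply: eq_bigr => s _ /=.
  by rewrite /gap sumrB -!(raddf_sum Posz).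
have -> : \sum_(l : Zmod e) ((runners lam c l)%:Z ^+ 2 - (runners (empty_mp r) c l)%:Z ^+ 2) =
    (\sum_l P l ^ 2)%N%:Z - (\sum_l P0 l ^ 2)%N%:Z.
  rewrite !(raddf_sum Posz) -sumrB; apply: eq_bigr => l _ /=.
  by rewrite /P /P0 -!mulnn !PoszM !expr2.
have E1 := energy _ sh bal; rewrite -(content_beads (0 : Zmod e) ca) in E1.
have E0 := energy (empty_mp r) (fun k => @core_shape_empty e (c k))
  (fun l => balanced_window l e0 core_window).
have arith (w y l0 l1 q0 q1 t : nat) : (r * (2 * y) + 2 * l0 = q0 + t)%N ->
    (r * (2 * (w + y)) + 2 * l1 = q1 + t)%N ->
    2 * r%:Z * w%:Z - (q1%:Z - q0%:Z) = 2 * (l0%:Z - l1%:Z) by nia.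
exact: arith E0 E1.
Qed.

End CoreWeight.

(** * Potentials from the three conditions on a hub *)

(** Modulo e, the first moment of a hub is thus minus the sum of any of its
potentials: this turns the congruence between the hubs into one between the
sums of their potentials. *)
Lemma potential_moment e r theta (N : Zmod e -> int) : (0 < e)%N ->
  potential r theta N ->
  \sum_(0 <= x < e) x%:Z * theta (cl e x%:Z) =
  e%:Z * N (cl e e.-1%:Z) - \sum_l N l.
Proof.
move=> e0 pot.
have abel (n : nat) : (n <= e)%N -> \sum_(0 <= x < n) x%:Z * theta (cl e x%:Z) =
    n%:Z * N (cl e n.-1%:Z) - \sum_(0 <= x < n) N (cl e x%:Z).
  elim: n => [|[|n] IHn] ne; first by rewrite !big_geq // mul0r subrr.
    by rewrite !big_nat1 mul0r mul1r subrr.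
  rewrite big_nat_recr //= [X in _ = _ - X]big_nat_recr //= IHn ?(ltnW ne) // pot.
  have -> : (cl e n.+1%:Z == 0) = false by rewrite cl_eq0 // dvdzE /= gtnNdvd.
  have -> : cl e n.+1%:Z - cl e 1 = cl e n%:Z by rewrite clS addrK.
  have -> : n.+2%:Z = n.+1%:Z + 1 by rewrite -PoszD addn1.
  by rewrite /= mulr0; ring.
rewrite abel //; congr (_ - _).
case: e e0 N {theta pot abel} => // e _ N.
by rewrite big_mkord; apply: eq_bigr => x _; rewrite cl_val.
Qed.

Lemma val_pred e (l : Zmod e) : (0 < e)%N -> l != 0 ->
  ((l - cl e 1)%R : Zmod e).+1 = l :> nat.
Proof.
move=> e0 l0; have le : (l < e)%N by rewrite -[e in (_ < e)%N]prednK.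
have lp : (0 < l)%N by rewrite lt0n.
have -> : l - cl e 1 = cl e l.-1%:Z.
  by rewrite -{1}(cl_val l e0) -[in LHS](prednK lp) clS addrK.
by rewrite val_cl_nat // modn_small ?prednK //; lia.
Qed.

Lemma val_opp1 e : (0 < e)%N -> ((0 - cl e 1)%R : Zmod e).+1 = e.
Proof.
move=> e0; rewrite sub0r -(_ : cl e e.-1%:Z = - cl e 1) ?val_cl_nat //.
  by rewrite modn_small ?prednK // ltn_predL.
apply/eqP; rewrite -subr_eq0 opprK -clS cl_eq0 // prednK //.
Qed.

(** Partial sums of theta; around the cycle they close up because the sum of
theta is -r. *)
Lemma potential_of_hub e r theta : (0 < e)%N -> is_hub (e := e) r theta ->
  exists N, potential r theta N.
Proof.
move=> e0 hub_r.
exists (fun l : Zmod e => \sum_(1 <= y < l.+1) theta (cl e y%:Z)) => l.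
have [->|l0] := eqVneq l 0; last first.
  rewrite val_pred // mulr0 subr0 big_nat_recr ?lt0n //= cl_val //.
  by rewrite [X in _ = X - _]addrC addrK.
rewrite val_opp1 // big_geq // sub0r mulr1.
have sumT : \sum_(0 <= y < e) theta (cl e y%:Z) = - r%:Z.
  rewrite -hub_r; case: e e0 theta {hub_r l} => // e _ theta.
  by rewrite big_mkord; apply: eq_bigr => y _; rewrite cl_val.
by rewrite -sumT [X in _ + X](big_ltn e0) cl0 addrC addrK.
Qed.

(** A block with hub theta gives Theta -> theta with its content as coefficients,
and coefficients m_l give the potential P0_l + m_l - m_(l+1), whose sum is that
of P0. In the third case, the sum of a potential is correct modulo e, and
adding a constant to the potential changes it by a multiple of e. *)
Lemma potential_exists e r (a : 'I_r -> Zmod e) c (theta : {ffun Zmod e -> int}) :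
  let Theta := hub a (empty_mp r) in
  (0 < e)%N -> is_hub r theta -> charge_for a (empty_mp r) c ->
  [\/ exists B : set (multipartition r), is_block a B /\ block_hub a B theta,
      mapsto Theta theta
    | (\sum_(0 <= x < e) x%:Z * theta (cl e x%:Z)
       = \sum_(0 <= x < e) x%:Z * Theta (cl e x%:Z) %[mod e%:Z])%Z] ->
  exists2 N, potential r theta N & \sum_l N l = (\sum_k c k)%N%:Z.
Proof.
move=> Theta e0 hub_r ca hyp.
pose P0 (l : Zmod e) := (runners (empty_mp r) c l)%:Z.
have pot0 : potential r Theta P0 by move=> l; exact: hub_runners.
have sum0 : \sum_l P0 l = (\sum_k c k)%N%:Z by rewrite -(@runners_total e _ (empty_mp r)) (raddf_sum Posz).
have case_mapsto : mapsto Theta theta ->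
    exists2 N, potential r theta N & \sum_l N l = (\sum_k c k)%N%:Z.
  case=> m mE; exists (fun l => P0 l + (m l)%:Z - (m (l + cl e 1))%:Z) => [l|].
    have -> : theta l = Theta l + (\sum_i alpha i *+ m i) l by rewrite -mE !ffunE addrC subrK.
    by rewrite pot0 sum_alphaE subrK; ring.
  rewrite sumrB big_split /= sum0 [X in _ + X - _](reindex_inj (addIr (cl e 1))).
  by rewrite addrK.
case: hyp => [[B [[lam BE] Bhub]]|//|cong].
  apply: case_mapsto; exists (content a lam); rewrite -hub_content //.
  by rewrite (Bhub lam) // BE.
have [N pot] := potential_of_hub e0 hub_r.
have [z zE] : exists z, \sum_l N l - (\sum_k c k)%N%:Z = z * e%:Z.
  apply/dvdzP; move/eqP: cong; rewrite eqz_mod_dvd.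
  rewrite (potential_moment e0 pot) (potential_moment e0 pot0) sum0.
  set S := \sum_l N l; set n1 := N _; set n2 := P0 _ => dv.
  have -> : S - (\sum_k c k)%N%:Z = e%:Z * (n1 - n2)
     - (e%:Z * n1 - S - (e%:Z * n2 - (\sum_k c k)%N%:Z)) by ring.
  by rewrite rpredB // dvdz_mulr.
exists (fun l => N l - z) => [l|]; first by rewrite pot; ring.
have sumz : \sum_(l : Zmod e) z = z * e%:Z.
  by rewrite sumr_const card_ord -mulr_natr natz prednK.
by rewrite sumrB sumz -zE; ring.
Qed.

(** * Existence and invariants of core blocks *)

(** The core is found by choosing the charges well: the initial charges all lie
within e of each other, and adding e to the s0 smallest ones keeps this true,
where s0 minimises the gap. *)
Lemma core_block_with_hub e r (a : 'I_r -> Zmod e) (theta : {ffun Zmod e -> int})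
    (N : Zmod e -> int) : (0 < e)%N -> (0 < r)%N -> potential r theta N ->
  \sum_l N l = (\sum_k (a k + e * 1))%N%:Z ->
  exists2 lam, core_block a [set mu | content a mu = content a lam] &
    hub a lam = theta.
Proof.
move=> e0 r0 pot NC.
(* A common translation that makes every row sum at least r, hence every entry
   of the final matrix positive. *)
pose K := (\sum_l `|N l|).+1%N.
have NK l : (`|N l| < K)%N by rewrite /K (bigD1 l) //= ltnS leq_addr.
pose A k := (a k + e * K.+1)%N.
pose Q l := `|(N l + (r * K)%N%:Z)%R|%N.
have QE l : (Q l)%:Z = N l + (r * K)%N%:Z by rewrite /Q; have := NK l; nia.
have Qr l : (r <= Q l)%N.
  have := QE l; have := NK l; rewrite /K => lt; rewrite mulnS PoszD => QlE.
  have : (\sum_l `|N l| <= r * \sum_l `|N l|)%N by rewrite leq_pmull.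
  by lia.
pose Q0 (l : Zmod e) := runners (empty_mp r) A l.
have sumQ : (\sum_l Q0 l = \sum_l Q l)%N.
  apply/eqP; rewrite -eqz_nat runners_total [X in _ == X](raddf_sum Posz); apply/eqP.
  rewrite [RHS](eq_bigr _ (fun l _ => QE l)) [X in _ = X]big_split /= NC /A.
  rewrite sumr_const card_ord -[_ *+ _](_ : (\sum_(k < r) e * K)%N%:Z = _).
    by rewrite -PoszD -big_split; congr Posz; apply: eq_bigr => k _ /=; lia.
  by rewrite sum_nat_const card_ord prednK // -mulr_natr natz -PoszM; congr Posz; lia.
have [s0 s0r gap_min] : exists2 s0, (s0 < r)%N & forall s, gap r Q0 Q s0 <= gap r Q0 Q s.
  case: (@arg_minP _ _ _ (Ordinal r0) xpredT (fun s : 'I_r => gap r Q0 Q s)) => // s _ smin.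
  exists s => // t; rewrite (gap_mod r0 sumQ t).
  exact: (smin (Ordinal (ltn_pmod t r0))).
have [Y Ys small] := smallest_set A (ltnW s0r).
pose c k := (A k + (k \in Y) * e)%N.
have ca : charge_for a (empty_mp r) c.
  move=> k; split; last by rewrite /c /A /=; nia.
  by rewrite /c /A -addnA [((k \in Y) * e)%N]mulnC -mulnDr cl_addM // cl_val.
have window j k : (c j <= c k + e)%N.
  have ae i : (a i < e)%N by rewrite -[e in (_ < e)%N]prednK.
  rewrite /c; have := small j k; have := ae j; have := ae k; rewrite /A.
  by case: (j \in Y); case: (k \in Y) => /=; lia.
(* Each of the s0 charges raised by e adds one bead to every runner. *)
have P0E l : runners (empty_mp r) c l = (Q0 l + s0)%N.
  rewrite /Q0 /runners -Ys -sum1_card [X in (_ + X)%N]big_mkcond -big_split.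
  apply: eq_bigr => k _ /=; rewrite /c; case: (k \in Y) => /=.
    by rewrite mul1n runner_empty_period // addn1.
  by rewrite mul0n !addn0.
pose P l := (Q l + s0)%N.
have low_mono s n : (low_sum r s0 n <= low_sum r (s0 + s) n)%N.
  elim: s => [|s IHs]; first by rewrite addn0.
  by rewrite addnS low_sumS; apply: leq_trans IHs (leq_addr _ _).
(* Adding s0 to the row sums shifts the argument of the gap by s0. *)
have low_shift s n : low_sum r s (n + s0) = (low_sum r (s0 + s) n - low_sum r s0 n)%N.
  elim: s => [|s IHs]; first by rewrite low_sum0 addn0 subnn.
  by rewrite addnS !low_sumS IHs -addnA addnBAC.
have dom (X : {set 'I_r}) :
    (\sum_(l : Zmod e) low_sum r #|X| (P l) <= \sum_(k in X) c k)%N.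
  have tot : (\sum_(k in X) c k =
      \sum_(l : Zmod e) \sum_(k in X) runner empty_partition (c k) l)%N.
    by rewrite exchange_big; apply: eq_bigr => k _; rewrite runner_total.
  apply: (@leq_trans (\sum_(l : Zmod e) low_sum r #|X| (runners (empty_mp r) c l))).
    rewrite -lez_nat !(raddf_sum Posz) /= -subr_ge0 -sumrB.
    have := gap_min (s0 + #|X|)%N; rewrite -subr_ge0 /gap -sumrB.
    congr (0 <= _); apply: eq_bigr => l _.
    rewrite P0E /P !low_shift.
    by rewrite -!subzn ?low_mono //; ring.
  rewrite tot leq_sum // => l _.
  exact: (low_sum_le r0 (balanced_window l e0 window)).
have sumPc : (\sum_l P l = \sum_k c k)%N.
  rewrite -(@runners_total e _ (empty_mp r)) (eq_bigr _ (fun l _ => P0E l)).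
  by rewrite !big_split sumQ.
have [p [balp rowp colp]] := balanced_matrix r0 sumPc dom.
have p0 k : (0 < p 0%R k)%N.
  have /andP[h _] := balanced_divn r0 (balp 0%R) k; apply: leq_trans h.
  by rewrite rowp divn_gt0 // /P; have := Qr 0%R; lia.
have [lam [calam core runs]] :=
  core_block_exists e0 r0 (fun k => (ca k).1) colp p0 balp.
exists lam => //; apply/ffunP => l; rewrite (hub_runners l calam) pot !runs !rowp /P.
by rewrite !PoszD !QE; ring.
Qed.

Lemma core_block_data e r (a : 'I_r -> Zmod e) B : (0 < e)%N -> core_block a B ->
  exists lam c, [/\ B = [set mu | content a mu = content a lam],
    charge_for a lam c, forall k, core_shape e (lam k) (c k) &
    forall l : Zmod e, balanced (fun k => runner (lam k) (c k) l)].
Proof.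
move=> e0 [[mu ->] [lam [lamB mc [ahat [b [mch top]]]]]].
have [c [ca sh bal]] := core_charge e0 mc mch top.
by exists lam, c; split=> //; apply/seteqP; split=> nu /=; rewrite lamB.
Qed.

Lemma core_block_vectors e r (a : 'I_r -> Zmod e) lam c :
  let Theta := hub a (empty_mp r) in let theta := hub a lam in
  (0 < e)%N -> (0 < r)%N -> charge_for a lam c ->
  (forall k, core_shape e (lam k) (c k)) ->
  (forall l : Zmod e, balanced (fun k => runner (lam k) (c k) l)) ->
  let h := ((\sum_k c k) %% e)%N in
  [/\ common_reduction r theta h, common_reduction r Theta h,
      mapsto (vvec r h Theta) (vvec r h theta) &
      weight a lam = (ht (vvec r h theta - vvec r h Theta))%:R].
Proof.
move=> Theta theta e0 r0 ca sh bal h.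
have ca0 := charge_for_empty ca.
have pot : potential r theta (fun l => (runners lam c l)%:Z).
  by move=> l; exact: hub_runners.
have pot0 : potential r Theta (fun l => (runners (empty_mp r) c l)%:Z).
  by move=> l; exact: hub_runners.
have NC (mu : multipartition r) :
    \sum_(l : Zmod e) (runners mu c l)%:Z = (\sum_k c k)%N%:Z.
  by rewrite -(@runners_total e _ mu) (raddf_sum Posz).
have sumP : (\sum_(l : Zmod e) runners (empty_mp r) c l = \sum_(l : Zmod e) runners lam c l)%N.
  by rewrite !runners_total.
have := vvec_gap e0 r0 pot0 pot sumP (core_gap_ge0 e0 r0 bal).
rewrite runners_total -/h => -[m [mE [j mj] summ]].
split.
- exact: potential_reduction (NC lam).
- exact: potential_reduction (NC (empty_mp r)).
- by exists m.
- by rewrite (ht_eq r0 mE mj) (core_weight e0 r0 ca sh bal) -summ.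
Qed.

(** * Uniqueness of the core block *)

(** If the contents differ by the constant d, then the linear part of the weight
differs by r d and the quadratic part does not change. *)
Lemma content_hub_weight e r (a : 'I_r -> Zmod e) lam mu : (0 < e)%N -> (0 < r)%N ->
  hub a lam = hub a mu -> weight a lam = weight a mu -> content a lam = content a mu.
Proof.
move=> e0 r0 same_hub same_weight.
pose d (l : Zmod e) : int := (content a lam l)%:Z - (content a mu l)%:Z.
have dE l : d l = d 0.
  apply: harmonic_const => // j.
  have := hub_content a mu e0; rewrite -same_hub (hub_content a lam e0).
  by move/(congr1 (fun f : {ffun Zmod e -> int} => f j)); rewrite !sum_alphaE /d; lia.
have contE l : (content a lam l)%:R = (content a mu l)%:R + (d 0)%:~R :> rat.
  by rewrite -(dE l) /d rmorphB /= addrC subrK.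
suff d0 : d 0 = 0.
  apply/ffunP => l; apply/eqP; rewrite -eqz_nat -subr_eq0; apply/eqP.
  by rewrite -d0 -(dE l).
move/eqP: same_weight; rewrite /weight.
under [X in _ - _ * X == _]eq_bigr do rewrite !contE opprD addrACA subrr addr0.
rewrite (inj_eq (addIr _)) (eq_bigr _ (fun j _ => contE (a j))) big_split /=.
rewrite -subr_eq0 addrAC subrr add0r sumr_const card_ord mulrn_eq0 intr_eq0.
by rewrite eqn0Ngt r0 => /eqP.
Qed.

Theorem theorem4p14 (r e : nat) (hr : (1 <= r)%N) (he : (2 <= e)%N)
    (a : 'I_r -> Zmod e) (theta : {ffun Zmod e -> int})
    (htheta : is_hub r theta) :
  let Theta := hub a (empty_mp r) in
  [\/ exists B : set (multipartition r), is_block a B /\ block_hub a B theta,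
      mapsto Theta theta
    | (\sum_(0 <= x < e) x%:Z * theta (cl e x%:Z)
       = \sum_(0 <= x < e) x%:Z * Theta (cl e x%:Z) %[mod e%:Z])%Z] ->
  exists h : nat,
    [/\ common_reduction r theta h, common_reduction r Theta h,
        mapsto (vvec r h Theta) (vvec r h theta),
        (exists! B : set (multipartition r),
           core_block a B /\ block_hub a B theta)
      & forall B : set (multipartition r),
          core_block a B -> block_hub a B theta ->
          block_weight a B (ht (vvec r h theta - vvec r h Theta))%:R].
Proof.
move=> Theta hyp.
have e0 : (0 < e)%N := ltnW he.
have same_hub lam mu : content a mu = content a lam -> hub a mu = hub a lam.
  move=> mulam; apply: (addIr (- Theta)).
  by rewrite !hub_content // mulam.
have ca1 : charge_for a (empty_mp r) (fun k => a k + e * 1)%N.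
  by apply: charge_for_addM => // k; rewrite muln1.
have [N pot NC] := potential_exists e0 htheta ca1 hyp.
have [lam core lam_theta] := core_block_with_hub e0 hr pot NC.
set B0 := [set mu | content a mu = content a lam] in core.
have hub0 : block_hub a B0 theta by move=> mu mulam; rewrite (same_hub lam).
have vectors B : core_block a B -> block_hub a B theta ->
    exists mu c, [/\ B = [set nu | content a nu = content a mu], hub a mu = theta,
      charge_for a mu c &
    let h := ((\sum_k c k) %% e)%N in
  [/\ common_reduction r theta h, common_reduction r Theta h,
      mapsto (vvec r h Theta) (vvec r h theta) &
      weight a mu = (ht (vvec r h theta - vvec r h Theta))%:R]].
  move=> coreB hubB; have [mu [c [BE ca sh bal]]] := core_block_data e0 coreB.
  have mu_theta : hub a mu = theta by apply: hubB; rewrite BE.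
  exists mu, c; split=> //.
  by have := core_block_vectors e0 hr ca sh bal; rewrite mu_theta.
have [mu0 [c0 [BE0 mu0_theta ca0]]] := vectors B0 core hub0.
set h := ((\sum_k c0 k) %% e)%N => -[red red0 map w0].
have weightB B : core_block a B -> block_hub a B theta ->
    block_weight a B (ht (vvec r h theta - vvec r h Theta))%:R.
  move=> coreB hubB nu; have [mu [c [-> mu_theta ca [redB _ _ wB]]]] := vectors B coreB hubB.
  move=> numu; have -> : weight a nu = weight a mu by rewrite /weight numu.
  rewrite wB; congr (ht _)%:R.
  (* The charges of the two blocks may differ, but h is the common reduction of
     the t_i(theta), which depends on theta only. *)
  have -> // : ((\sum_k c k) %% e)%N = h.
  have [_ redi] := redB; have [_ redi0] := red.
  by have := redi 0; rewrite redi0 /h !modn_mod.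
exists h; split=> //.
exists B0; split=> // B [coreB hubB].
have [mu [c [BE mu_theta ca _]]] := vectors B coreB hubB.
suff contE : content a mu = content a mu0 by rewrite BE BE0 contE.
apply: content_hub_weight => //; first by rewrite mu_theta mu0_theta.
by rewrite w0 (weightB B) // BE.
Qed.
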